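(* Let $\Lambda$ be a compact path-connected metric space and let $\mathbb{A}\colon\Lambda\times\mathbb{Z}\to\mathcal{L}(\mathbb{R}^d)$ satisfy (L0) and admit an exponential dichotomy both on $\mathbb{Z}^+_{\overline{\kappa}}$ and on $\mathbb{Z}^-_{\underline{\kappa}}$, with parametrized projectors $\mathbb{P}^+\colon\Lambda\times\mathbb{Z}^+_{\overline{\kappa}}\to\mathcal{L}(\mathbb{R}^d)$ and $\mathbb{P}^-\colon\Lambda\times\mathbb{Z}^-_{\underline{\kappa}}\to\mathcal{L}(\mathbb{R}^d)$, where $\underline{\kappa}<0<\overline{\kappa}$. Define $L_{\mathbb{A}}\colon\Lambda\to\mathcal{L}(\ell_0(\mathbb{R}^d))$ by $(L_{\mathbb{A}}(\lambda)\phi)(n):=\phi(n+1)-\mathbb{A}_n(\lambda)\phi(n)$. Then (a) $L_{\mathbb{A}}$ is a continuous family of Fredholm operators; (b) its index bundle is $\operatorname{ind}(L_{\mathbb{A}})=[\operatorname{IM}\mathbb{P}^+(\overline{\kappa})]-[\operatorname{IM}\mathbb{P}^-(\underline{\kappa})]\in KO(\Lambda)$, where $\operatorname{IM}\mathbb{P}^\pm(\kappa):=\{(\lambda,x)\in\Lambda\times\mathbb{R}^d: x\in\operatorname{im}\mathbb{P}^\pm(\lambda,\kappa)\}$.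
   Context: $\ell_0(\mathbb{R}^d)$: sequences $\mathbb{Z}\to\mathbb{R}^d$ converging to $0$ at $\pm\infty$, sup norm. (L0): the family $\{\mathbb{A}_n\colon\Lambda\to\mathcal{L}(\mathbb{R}^d)\}_{n\in\mathbb{Z}}$ is equicontinuous and pointwise bounded. $\mathbb{Z}^+_\kappa=\mathbb{Z}\cap[\kappa,\infty)$, $\mathbb{Z}^-_\kappa=\mathbb{Z}\cap(-\infty,\kappa]$. For a discrete vector field $\mathbb{B}\colon\mathbb{Z}\to\mathcal{L}(\mathbb{R}^d)$, $\Phi(k,n):=\mathbb{B}_{k-1}\circ\cdots\circ\mathbb{B}_n$ ($k>n$), $\Phi(n,n)=\mathrm{id}$. A projector on $\mathbb{I}$ is $\mathbb{P}\colon\mathbb{I}\to\mathcal{L}(\mathbb{R}^d)$ with $\mathbb{P}(n)^2=\mathbb{P}(n)$; invariant w.r.t. $\mathbb{B}$ if $\mathbb{B}_n\mathbb{P}(n)=\mathbb{P}(n+1)\mathbb{B}_n$ whenever $n,n+1\in\mathbb{I}$ and $\sup_n\|\mathbb{P}(n)\|<\infty$; regular if moreover $\mathbb{B}_n|_{\ker\mathbb{P}(n)}\colon\ker\mathbb{P}(n)\to\ker\mathbb{P}(n+1)$ is an isomorphism whenever $n,n+1\in\mathbb{I}$. $\mathbb{A}\colon\Lambda\times\mathbb{Z}\to\mathcal{L}(\mathbb{R}^d)$ possesses an exponential dichotomy on $\mathbb{I}$ with parametrized projector $\mathbb{P}\colon\Lambda\times\mathbb{I}\to\mathcal{L}(\mathbb{R}^d)$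 if each $\mathbb{P}_n\colon\Lambda\to\mathcal{L}(\mathbb{R}^d)$ is continuous and there are $K\geq1$, $\alpha\in(0,1)$ such that for every $\lambda$, $\mathbb{P}(\lambda)$ is an invariant regular projector for $\mathbb{A}(\lambda)$ and $|\Phi_\lambda(k,n)\mathbb{P}(\lambda,n)x|\leq K\alpha^{k-n}|\mathbb{P}(\lambda,n)x|$, $|\Phi_\lambda(k,n)(I-\mathbb{P}(\lambda,n))x|\geq K^{-1}\alpha^{-(k-n)}|(I-\mathbb{P}(\lambda,n))x|$ for all $k\geq n$ in $\mathbb{I}$, $x\in\mathbb{R}^d$ ($\Phi_\lambda$ the transition operator of $\mathbb{A}(\lambda)$). These $\operatorname{IM}\mathbb{P}^\pm(\kappa)$ are vector bundles over $\Lambda$. $KO(\Lambda)$ is the Grothendieck group of isomorphism classes of real vector bundles over $\Lambda$ (elements $[E]-[F]$). Index bundle: for a continuous family $L\colon\Lambda\to\Phi(X,Y)$ of Fredholm operators between Banach spaces, choose a finite-dimensional subspace $V\subset Y$ with $\operatorname{im}L(\lambda)+V=Y$ for all $\lambda$; then $E(L,V):=\bigcup_\lambda\{\lambda\}\times L(\lambda)^{-1}(V)$ is a vector bundle and $\operatorname{ind}(L):=[E(L,V)]-[\Lambda\times V]\in KO(\Lambda)$ (independent of $V$). *)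

(* Defs.v *)
From HB Require Import structures.
From mathcomp Require Import all_boot all_order all_algebra.
From mathcomp Require Import all_classical all_reals all_analysis.
Set Implicit Arguments. Unset Strict Implicit. Unset Printing Implicit Defensive.
Import Order.TTheory GRing.Theory Num.Theory.
Import numFieldNormedType.Exports.
Local Open Scope classical_set_scope.
Local Open Scope ring_scope.

Section Defs.
Variable R : realType.

Definition path_connected_space (T : topologicalType) : Prop :=
  forall x y : T, exists g : R -> T,
    {within `[0, 1], continuous g} /\ g 0 = x /\ g 1 = y.

Definition lin_on (X Y : lmodType R) (S : set X) (f : X -> Y) : Prop :=
  forall (a : R) (x y : X), S x -> S y -> f (a *: x + y) = a *: f x + f y.

Definition span_of (X : lmodType R) (k : nat) (s : 'I_k -> X) : set X :=
  [set x | exists c : 'I_k -> R, x = \sum_(i < k) c i *: s i].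

(* Phi B n m = Phi(n+m, n) = B_{n+m-1} ... B_n *)
Fixpoint Phi (d : nat) (B : int -> 'M[R]_d) (n : int) (m : nat) : 'M[R]_d :=
  match m with
  | 0 => 1%:M
  | m'.+1 => B (n + m'%:Z) *m Phi B n m'
  end.

Definition ker_mx (d : nat) (P : 'M[R]_d) : set 'cV[R]_d :=
  [set x | P *m x = 0].

Definition inv_reg_projector (d : nat) (B : int -> 'M[R]_d) (I : set int)
    (P : int -> 'M[R]_d) : Prop :=
  (forall n, I n -> P n *m P n = P n) /\
  (forall n, I n -> I (n + 1) -> B n *m P n = P (n + 1) *m B n) /\
  (exists M : R, forall n, I n -> `|P n| <= M) /\
  (forall n, I n -> I (n + 1) ->
     (forall x, ker_mx (P n) x -> ker_mx (P (n + 1)) (B n *m x)) /\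
     (forall x, ker_mx (P n) x -> B n *m x = 0 -> x = 0) /\
     (forall y, ker_mx (P (n + 1)) y -> exists2 x, ker_mx (P n) x & B n *m x = y)).

Definition exp_dichotomy (T : topologicalType) (d : nat)
    (A : int -> T -> 'M[R]_d) (I : set int) (P : T -> int -> 'M[R]_d) : Prop :=
  (forall n, I n -> continuous (fun l => P l n)) /\
  exists K alpha : R, 1 <= K /\ 0 < alpha < 1 /\
  forall l : T,
    inv_reg_projector (fun n => A n l) I (P l) /\
    forall (n : int) (m : nat) (x : 'cV[R]_d), I n -> I (n + m%:Z) ->
      `|Phi (fun j => A j l) n m *m (P l n *m x)|
          <= K * alpha ^+ m * `|P l n *m x| /\
      K^-1 * alpha ^- m * `|(1%:M - P l n) *m x|
          <= `|Phi (fun j => A j l) n m *m ((1%:M - P l n) *m x)|.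

Definition L0 (T : pseudoMetricType R) (d : nat) (A : int -> T -> 'M[R]_d) : Prop :=
  (forall (l0 : T) (e : R), 0 < e -> exists2 dl : R, 0 < dl &
     forall n l, ball l0 dl l -> `|A n l - A n l0| < e) /\
  (forall l : T, exists M : R, forall n, `|A n l| <= M).

Definition ell0 {d : nat} : set (int -> 'cV[R]_d) :=
  [set phi | forall e : R, 0 < e -> exists N : nat,
     forall n : int, (N%:Z <= `|n|)%R -> `|phi n| < e].

Definition supnorm (d : nat) (phi : int -> 'cV[R]_d) : R :=
  sup (range (fun n => `|phi n|)).

Definition LA (T : Type) (d : nat) (A : int -> T -> 'M[R]_d) (l : T)
    (phi : int -> 'cV[R]_d) : int -> 'cV[R]_d :=
  fun n => phi (n + 1) - A n l *m phi n.

Definition bounded_op_ell0 (d : nat) (L : (int -> 'cV[R]_d) -> (int -> 'cV[R]_d)) : Prop :=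
  (forall phi, ell0 phi -> ell0 (L phi)) /\ lin_on ell0 L /\
  exists C : R, forall phi, ell0 phi -> supnorm (L phi) <= C * supnorm phi.

Definition finite_dim_subspace_ell0 (d : nat) (V : set (int -> 'cV[R]_d)) : Prop :=
  exists k (s : 'I_k -> int -> 'cV[R]_d), (forall i, ell0 (s i)) /\ V = span_of s.

Definition fredholm_ell0 (d : nat) (L : (int -> 'cV[R]_d) -> (int -> 'cV[R]_d)) : Prop :=
  bounded_op_ell0 L /\
  finite_dim_subspace_ell0 [set phi | ell0 phi /\ L phi = 0] /\
  (forall (u : nat -> int -> 'cV[R]_d) (psi : int -> 'cV[R]_d),
     (forall j, exists2 phi, ell0 phi & u j = L phi) -> ell0 psi ->
     (forall e : R, 0 < e -> exists J : nat, forall j, (J <= j)%N -> supnorm (u j - psi) < e) ->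
     exists2 phi, ell0 phi & psi = L phi) /\
  (exists V, finite_dim_subspace_ell0 V /\
     forall psi, ell0 psi -> exists phi v, [/\ ell0 phi, V v & psi = L phi + v]).

Definition cont_fredholm_family (T : pseudoMetricType R) (d : nat)
    (L : T -> (int -> 'cV[R]_d) -> (int -> 'cV[R]_d)) : Prop :=
  (forall l, fredholm_ell0 (L l)) /\
  forall (l0 : T) (e : R), 0 < e -> exists2 dl : R, 0 < dl &
    forall l phi, ball l0 dl l -> ell0 phi ->
      supnorm (L l phi - L l0 phi) <= e * supnorm phi.

(* A bundle over T is a family of subsets E l of an ambient vector space X,
   whose topology is given by the norm nX. *)
Definition vbundle (T : pseudoMetricType R) (X : lmodType R) (nX : X -> R)
    (E : T -> set X) : Prop :=
  forall l0 : T, exists dl : R, 0 < dl /\ exists (k : nat) (phi : T -> 'cV[R]_k -> X),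
    (forall l, ball l0 dl l ->
       (forall (a : R) u v, phi l (a *: u + v) = a *: phi l u + phi l v) /\
       injective (phi l) /\ phi l @` setT = E l) /\
    (forall l1 v1, ball l0 dl l1 -> forall e : R, 0 < e -> exists2 eta : R, 0 < eta &
       forall l v, ball l0 dl l -> ball l1 eta l -> `|v - v1| < eta ->
         nX (phi l v - phi l1 v1) < e) /\
    (forall l1 v1, ball l0 dl l1 -> forall e : R, 0 < e -> exists2 eta : R, 0 < eta &
       forall l v, ball l0 dl l -> ball l1 eta l -> nX (phi l v - phi l1 v1) < eta ->
         `|v - v1| < e).

Definition bundle_iso (T : pseudoMetricType R) (X Y : lmodType R) (nX : X -> R) (nY : Y -> R)
    (E : T -> set X) (F : T -> set Y) : Prop :=
  exists f : T -> X -> Y,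
    (forall l, lin_on (E l) (f l) /\
       (forall x y, E l x -> E l y -> f l x = f l y -> x = y) /\ f l @` E l = F l) /\
    (forall l1 x1, E l1 x1 -> forall e : R, 0 < e -> exists2 eta : R, 0 < eta &
       forall l x, E l x -> ball l1 eta l -> nX (x - x1) < eta ->
         nY (f l x - f l1 x1) < e) /\
    (forall l1 x1, E l1 x1 -> forall e : R, 0 < e -> exists2 eta : R, 0 < eta &
       forall l x, E l x -> ball l1 eta l -> nY (f l x - f l1 x1) < eta ->
         nX (x - x1) < e).

Definition bsum (T : Type) (X Y : lmodType R) (E : T -> set X) (F : T -> set Y)
    : T -> set (X * Y)%type :=
  fun l => [set p | E l p.1 /\ F l p.2].

Definition nsum (X Y : lmodType R) (nX : X -> R) (nY : Y -> R) : (X * Y)%type -> R :=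
  fun p => Num.max (nX p.1) (nY p.2).

Definition cvnorm (k : nat) : 'cV[R]_k -> R := fun v => `|v|.

(* Equality  [E1] - [E2] = [F1] - [F2]  in KO(T) (Grothendieck group):
   E1 + F2 + G  ~=  F1 + E2 + G  for some vector bundle G
   (taken as a subbundle of a trivial bundle T x R^N). *)
Definition KO_eq (T : pseudoMetricType R)
    (X1 X2 Y1 Y2 : lmodType R) (n1 : X1 -> R) (n2 : X2 -> R) (m1 : Y1 -> R) (m2 : Y2 -> R)
    (E1 : T -> set X1) (E2 : T -> set X2) (F1 : T -> set Y1) (F2 : T -> set Y2) : Prop :=
  exists (N : nat) (G : T -> set 'cV[R]_N),
    vbundle (@cvnorm N) G /\
    bundle_iso (nsum (nsum n1 m2) (@cvnorm N)) (nsum (nsum m1 n2) (@cvnorm N))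
      (bsum (bsum E1 F2) G) (bsum (bsum F1 E2) G).

Definition IM (T : Type) (d : nat) (P : T -> int -> 'M[R]_d) (kappa : int)
    : T -> set 'cV[R]_d :=
  fun l => [set x | exists y, x = P l kappa *m y].

Definition EL (T : Type) (d : nat) (L : T -> (int -> 'cV[R]_d) -> (int -> 'cV[R]_d))
    (V : set (int -> 'cV[R]_d)) : T -> set (int -> 'cV[R]_d) :=
  fun l => [set phi | ell0 phi /\ V (L l phi)].

Definition admissible (T : Type) (d : nat) (L : T -> (int -> 'cV[R]_d) -> (int -> 'cV[R]_d))
    (V : set (int -> 'cV[R]_d)) : Prop :=
  finite_dim_subspace_ell0 V /\
  forall l psi, ell0 psi -> exists phi v, [/\ ell0 phi, V v & psi = L l phi + v].

End Defs.

(* Main.v *)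
Require Import Defs.
From HB Require Import structures.
From mathcomp Require Import all_boot all_order all_algebra.
From mathcomp Require Import all_classical all_reals all_analysis.
From mathcomp Require Import ring lra zify.
Import Order.TTheory GRing.Theory Num.Theory.
Import numFieldNormedType.Exports.
Local Open Scope classical_set_scope.
Local Open Scope ring_scope.

(** The operator [L] is bordered by adding a jump [w] in [R^d] to the equation at
    time [kup - 1] and prescribing the stable component of [phi] at [kup] and the
    unstable component at [klo].  For a fixed parameter the bordered operator
    [D (phi, w) = (L phi + w delta, P+ phi(kup), (1 - P-) phi(klo))] is an isomorphism
    of [ell0 x R^d] onto [ell0 x im P+ x ker P-]: on each half-line the dichotomy solves
    the inhomogeneous equation with the prescribed component, the gap between the
    half-lines is filled by forward iteration, and [w] absorbs the mismatch.  As [D]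
    is norm continuous in the parameter, so is its inverse.  Hence [L] is Fredholm,
    and for an admissible [V] the projection onto [w] splits, so that
    [E(V) + R^d ~ V + im P+ + ker P-]; adding [im P-] gives
    [E(V) + im P- + R^d ~ im P+ + V + R^d], the required equality in [KO]. *)

Set Implicit Arguments.
Unset Strict Implicit.
Unset Printing Implicit Defensive.

(** The kernel of [L] may change dimension with the parameter, while the bordered inverse varies
    continuously; so everything is expressed through that inverse. If [V] is spanned by k sequences,
    the data [u] = (coefficients, end values) range over a fixed [R^(k+e)], and the jump needed to
    solve with data [u] is [M u] for a finite matrix [M], called [defect]. For the empty family,
    kernel and range of [L] are read off from [M]. For an admissible [V], [M] is onto, so
    [M^T (M M^T)^-1] is a right inverse continuous in the parameter, and [E(V)] corresponds to the
    kernel of [M] on projected data, the image of a continuous projector. The coefficients in the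
    gap may be singular, so the gap can only be crossed forward in time; this is why the mismatch is
    placed in its last equation. Since [ell0] is a set of functions rather than a type, operator
    norms appear as pointwise bounds, and continuity of the inverse comes from absorbing a small
    multiple of [supnorm phi]. *)

(** * Matrix norms, convergence, and a continuous right inverse *)

Section MatrixNorm.
Variable R : realType.

Lemma mx_coord_le m n (A : 'M[R]_(m, n)) i j : `|A i j| <= `|A|.
Proof.
rewrite [leRHS]/Num.norm /= mx_normrE.
by apply/bigmax_geP; right; exists (i, j).
Qed.

Lemma mx_norm_le m n (A : 'M[R]_(m, n)) (b : R) :
  0 <= b -> (forall i j, `|A i j| <= b) -> `|A| <= b.
Proof.
move=> b0 Ab; rewrite [leLHS]/Num.norm /= mx_normrE.
by apply/bigmax_leP; split => // -[i j] _; exact: Ab.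
Qed.

Lemma mulmx_norm_le m n p (A : 'M[R]_(m, n)) (B : 'M[R]_(n, p)) :
  `|A *m B| <= n%:R * `|A| * `|B|.
Proof.
apply: mx_norm_le => [|i j]; first by rewrite !mulr_ge0.
rewrite mxE (le_trans (ler_norm_sum _ _ _))//.
rewrite -mulrA -[X in X%:R](card_ord n) mulr_natl -sumr_const.
by apply: ler_sum => k _; rewrite normrM ler_pM// mx_coord_le.
Qed.

Section Cvg.
Context {I : Type} {F : set_system I} {FF : Filter F}.

Lemma cvg_mxP m n (f : I -> 'M[R]_(m, n)) (a : 'M[R]_(m, n)) :
  f x @[x --> F] --> a <-> forall i j, f x i j @[x --> F] --> a i j.
Proof.
split=> [fa i j|fa].
  apply/cvgrPdist_le => e e0.
  have /cvgrPdist_le/(_ e e0) := fa; apply: filterS => x.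
  by apply: le_trans; have := mx_coord_le (a - f x) i j; rewrite !mxE.
apply/cvgrPdist_le => e e0.
suff: \forall x \near F, forall ij : 'I_m * 'I_n, `|a ij.1 ij.2 - f x ij.1 ij.2| <= e.
  apply: filterS => x H; apply: mx_norm_le => [|i j]; first exact: ltW.
  by rewrite !mxE; exact: (H (i, j)).
apply: filter_forall => -[i j] /=.
by have /cvgrPdist_le/(_ e e0) := fa i j.
Qed.

Lemma cvg_sumr (J : Type) (r : seq J) (P : pred J) (f : J -> I -> R) (a : J -> R) :
  (forall i, P i -> f i x @[x --> F] --> a i) ->
  \sum_(i <- r | P i) f i x @[x --> F] --> \sum_(i <- r | P i) a i.
Proof. by apply: cvg_big; exact: add_continuous. Qed.

Lemma cvg_prodr (J : Type) (r : seq J) (P : pred J) (f : J -> I -> R) (a : J -> R) :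
  (forall i, P i -> f i x @[x --> F] --> a i) ->
  \prod_(i <- r | P i) f i x @[x --> F] --> \prod_(i <- r | P i) a i.
Proof. by apply: cvg_big; exact: mul_continuous. Qed.

Lemma cvg_mulmx m n p (f : I -> 'M[R]_(m, n)) (g : I -> 'M[R]_(n, p))
    (a : 'M[R]_(m, n)) (b : 'M[R]_(n, p)) :
  f x @[x --> F] --> a -> g x @[x --> F] --> b ->
  f x *m g x @[x --> F] --> a *m b.
Proof.
move=> /cvg_mxP fa /cvg_mxP gb; apply/cvg_mxP => i j.
under eq_fun do rewrite mxE.
by rewrite mxE; apply: cvg_sumr => k _; exact: cvgM.
Qed.

Lemma cvg_trmx m n (f : I -> 'M[R]_(m, n)) (a : 'M[R]_(m, n)) :
  f x @[x --> F] --> a -> (f x)^T @[x --> F] --> a^T.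
Proof.
move=> /cvg_mxP fa; apply/cvg_mxP => i j.
by under eq_fun do rewrite mxE; rewrite mxE; exact: fa.
Qed.

Lemma cvg_col_mx m n p (f : I -> 'M[R]_(m, p)) (g : I -> 'M[R]_(n, p))
    (a : 'M[R]_(m, p)) (b : 'M[R]_(n, p)) :
  f x @[x --> F] --> a -> g x @[x --> F] --> b ->
  col_mx (f x) (g x) @[x --> F] --> col_mx a b.
Proof.
move=> /cvg_mxP fa /cvg_mxP gb; apply/cvg_mxP => i j.
rewrite mxE; under eq_fun do rewrite mxE.
by case: (fintype.split i) => k; [exact: fa|exact: gb].
Qed.

Lemma cvg_block_diag m n (f : I -> 'M[R]_m) (g : I -> 'M[R]_n)
    (a : 'M[R]_m) (b : 'M[R]_n) :
  f x @[x --> F] --> a -> g x @[x --> F] --> b ->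
  block_mx (f x) 0 0 (g x) @[x --> F] --> block_mx a 0 0 b.
Proof.
move=> fa gb; apply: cvg_col_mx; apply/cvg_mxP => i j.
- rewrite mxE; under eq_fun do rewrite mxE.
  by case: (fintype.split j) => k; [move/cvg_mxP: fa; exact|under eq_fun do rewrite mxE; rewrite mxE; exact: cvg_cst].
- rewrite mxE; under eq_fun do rewrite mxE.
  by case: (fintype.split j) => k; [under eq_fun do rewrite mxE; rewrite mxE; exact: cvg_cst|move/cvg_mxP: gb; exact].
Qed.

Lemma cvg_usubmx m n p (f : I -> 'M[R]_(m + n, p)) (a : 'M[R]_(m + n, p)) :
  f x @[x --> F] --> a -> usubmx (f x) @[x --> F] --> usubmx a.
Proof.
move=> /cvg_mxP fa; apply/cvg_mxP => i j.
by rewrite mxE; under eq_fun do rewrite mxE; exact: fa.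
Qed.

Lemma cvg_dsubmx m n p (f : I -> 'M[R]_(m + n, p)) (a : 'M[R]_(m + n, p)) :
  f x @[x --> F] --> a -> dsubmx (f x) @[x --> F] --> dsubmx a.
Proof.
move=> /cvg_mxP fa; apply/cvg_mxP => i j.
by rewrite mxE; under eq_fun do rewrite mxE; exact: fa.
Qed.

Lemma cvg_det n (f : I -> 'M[R]_n) (a : 'M[R]_n) :
  f x @[x --> F] --> a -> \det (f x) @[x --> F] --> \det a.
Proof.
move=> /cvg_mxP fa; apply: cvg_sumr => s _.
by apply: cvgM; [exact: cvg_cst|apply: cvg_prodr => i _; exact: fa].
Qed.

Lemma cvg_adjmx n (f : I -> 'M[R]_n) (a : 'M[R]_n) :
  f x @[x --> F] --> a -> \adj (f x) @[x --> F] --> \adj a.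
Proof.
move=> /cvg_mxP fa; apply/cvg_mxP => i j.
rewrite mxE; under eq_fun do rewrite mxE.
apply: cvgM; first exact: cvg_cst.
apply: cvg_det; apply/cvg_mxP => k l.
by rewrite !mxE; under eq_fun do rewrite !mxE; exact: fa.
Qed.

Lemma near_unitmx n (f : I -> 'M[R]_n) (a : 'M[R]_n) :
  f x @[x --> F] --> a -> a \in unitmx -> \forall x \near F, f x \in unitmx.
Proof.
move=> /cvg_det fa; rewrite unitmxE unitfE => a0.
have /cvgrPdist_lt/(_ `|\det a|) := fa; rewrite normr_gt0 => /(_ a0).
apply: filterS => x H; rewrite unitmxE unitfE; apply: contraTN H => /eqP->.
by rewrite subr0 ltxx.
Qed.

(** By Cramer's rule. As [invmx] is defined by cases, the adjugate formula holds only where [f x] is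
    invertible, which [near_unitmx] grants eventually. *)
Lemma cvg_invmx n (f : I -> 'M[R]_n) (a : 'M[R]_n) :
  f x @[x --> F] --> a -> a \in unitmx ->
  invmx (f x) @[x --> F] --> invmx a.
Proof.
move=> fa ua; have uf := near_unitmx fa ua.
rewrite [in X in _ --> X]/invmx ua.
apply: (@cvg_trans _ ((\det (f x))^-1 *: \adj (f x) @[x --> F])).
  by apply: near_eq_cvg; apply: filterS uf => x ux; rewrite /invmx ux.
have /cvg_mxP fadj := cvg_adjmx fa.
apply/cvg_mxP => i j.
rewrite mxE; under eq_fun do rewrite mxE.
apply: cvgM => //; apply: cvgV; last exact: cvg_det.
by move: ua; rewrite unitmxE unitfE.
Qed.

End Cvg.

Lemma mulmx_tr_eq0 m (v : 'rV[R]_m) : v *m v^T = 0 -> v = 0.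
Proof.
move=> /matrixP/(_ 0 0); rewrite !mxE => vv; apply/rowP => j; rewrite mxE.
have : \sum_i v 0 i ^+ 2 = 0.
  by rewrite -[RHS]vv; apply: eq_bigr => k _; rewrite mxE expr2.
move=> /eqP; rewrite psumr_eq0 => [/allP/(_ j)|i _]; last exact: sqr_ge0.
by rewrite mem_index_enum /= => /(_ isT); rewrite sqrf_eq0 => /eqP.
Qed.

(** Positivity of sums of squares is used twice: [v M M^T = 0] forces [v M = 0], and writing
    [v^T = M u] then gives [v v^T = 0]. *)
Lemma mulmx_tr_unit d e (M : 'M[R]_(d, e)) :
  (forall w : 'cV_d, exists u, M *m u = w) -> M *m M^T \in unitmx.
Proof.
move=> Ms; rewrite -row_free_unit; apply/row_freeP.
suff H : row_free (M *m M^T) by move/row_freeP: H.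
rewrite -kermx_eq0; apply/eqP/row_matrixP => i; rewrite row0.
set v := row i _.
have vM : v *m M = 0.
  apply: mulmx_tr_eq0; rewrite trmx_mul mulmxA -(mulmxA v).
  have -> : v *m (M *m M^T) = 0 by rewrite /v -row_mul mulmx_ker row0.
  by rewrite mul0mx.
have [u Mu] := Ms v^T.
by apply: mulmx_tr_eq0; rewrite -Mu mulmxA vM mul0mx.
Qed.

(** For full row rank this is the Moore-Penrose inverse: a right inverse given by a formula
    continuous in [M]. *)
Definition rinv d e (M : 'M[R]_(d, e)) : 'M[R]_(e, d) := M^T *m invmx (M *m M^T).

Lemma mulmx_rinv d e (M : 'M[R]_(d, e)) :
  (forall w : 'cV_d, exists u, M *m u = w) -> M *m rinv M = 1%:M.
Proof. by move=> Ms; rewrite /rinv mulmxA mulmxV // mulmx_tr_unit. Qed.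

Lemma cvg_rinv {I : Type} {F : set_system I} {FF : Filter F} d e
    (f : I -> 'M[R]_(d, e)) (a : 'M[R]_(d, e)) :
  (forall w : 'cV_d, exists u, a *m u = w) ->
  f x @[x --> F] --> a -> rinv (f x) @[x --> F] --> rinv a.
Proof.
move=> sa fa; have fT := cvg_trmx fa.
apply: cvg_mulmx; first exact: fT.
by apply: cvg_invmx; [apply: cvg_mulmx; [exact: fa|exact: fT]|exact: mulmx_tr_unit].
Qed.

End MatrixNorm.

(** * Contracting recursions on the natural numbers *)

Section Recursions.
Variables (R : realType) (d : nat).
Implicit Types (f h : nat -> 'M[R]_d) (g s u : nat -> 'cV[R]_d).

(** Transition product of [s (m+1) = f m s m]; [bwd_prod] is the one of [u m = h m u (m+1)]. Both
    split off the factor of lowest index. *)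
Fixpoint fwd_prod f (m j : nat) : 'M[R]_d :=
  if j is j'.+1 then fwd_prod f m.+1 j' *m f m else 1%:M.

Fixpoint bwd_prod h (m j : nat) : 'M[R]_d :=
  if j is j'.+1 then h m *m bwd_prod h m.+1 j' else 1%:M.

Definition nullseq (V : normedZmodType R) (s : nat -> V) : Prop :=
  forall e : R, 0 < e -> exists N : nat, forall m, (N <= m)%N -> `|s m| <= e.

Variables (C alpha : R).
Hypotheses (C0 : 0 <= C) (a0 : 0 < alpha) (a1 : alpha < 1).

Let a1' : 0 < 1 - alpha. Proof. by rewrite subr_gt0. Qed.

Lemma geometric_null (B e : R) : 0 < e ->
  exists N : nat, forall m, (N <= m)%N -> alpha ^+ m * B <= e.
Proof.
move=> e0.
have : (geometric B alpha : R^nat) @ \oo --> 0.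
  by apply: cvg_geometric; rewrite gtr0_norm.
move=> /cvgrPdist_le/(_ e e0)[N _ HN]; exists N => m /HN /=.
by rewrite sub0r normrN mulrC => /(le_trans (ler_norm _)).
Qed.

Fixpoint majorant (r0 : R) (t : nat -> R) (m : nat) : R :=
  if m is m'.+1 then alpha * majorant r0 t m' + t m' else r0.

(* The weighted bound [|F(m, j) s_m| <= alpha^j r_m] plays the role of an
   adapted norm: it makes the induction go through with rate [alpha] although
   the constant [C] may exceed [1]. *)
Lemma forward_majorant f g s :
  (forall m j (x : 'cV[R]_d), `|fwd_prod f m j *m x| <= C * alpha ^+ j * `|x|) ->
  (forall m, s m.+1 = f m *m s m + g m) ->
  forall m, `|s m| <= majorant (C * `|s 0%N|) (fun i => C * `|g i|) m.
Proof.
move=> fC sE m.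
suff H j : `|fwd_prod f m j *m s m| <=
    alpha ^+ j * majorant (C * `|s 0%N|) (fun i => C * `|g i|) m.
  by have := H 0%N; rewrite /= mul1mx expr0 mul1r.
elim: m j => [|m IH] j; first by rewrite mulrA (mulrC _ C); exact: fC.
rewrite sE mulmxDr mulmxA (le_trans (ler_normD _ _))//= mulrDr lerD//.
  by have := IH j.+1; rewrite /= exprS (mulrC alpha) -mulrA.
by rewrite mulrA (mulrC _ C); exact: fC.
Qed.

Lemma majorant_le (r0 b : R) (t : nat -> R) : 0 <= b ->
  r0 <= b -> (forall m, t m <= b) ->
  forall m, majorant r0 t m <= b / (1 - alpha).
Proof.
move=> b0 rb tb; elim=> [|m IH] /=.
  rewrite (le_trans rb)// ler_pdivlMr// ler_piMr// lerBlDr lerDl; exact: ltW.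
(* [b / (1 - alpha)] is the fixed point of [x => alpha * x + b], so the bound reproduces itself. *)
have -> : b / (1 - alpha) = alpha * (b / (1 - alpha)) + b.
  by field; rewrite gt_eqF.
by rewrite lerD// ler_wpM2l// ltW.
Qed.

Lemma majorant_null (r0 : R) (t : nat -> R) :
  (forall m, 0 <= t m) -> nullseq t ->
  forall e : R, 0 < e -> exists N : nat, forall m, (N <= m)%N -> majorant r0 t m <= e.
Proof.
move=> t0 tnull e e0.
have e20 : 0 < e / 2 by rewrite divr_gt0.
(* Inputs of this size have [e / 2] as fixed point; beyond [N] the excess over [e / 2] decays like
   [alpha ^+ j]. *)
have [N HN] := tnull ((1 - alpha) * (e / 2)) (mulr_gt0 a1' e20).
have key j : majorant r0 t (N + j) <= alpha ^+ j * `|majorant r0 t N| + e / 2.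
  elim: j => [|j IH]; first by rewrite addn0 mul1r ler_wpDr ?ler_norm// ltW.
  have tN : t (N + j)%N <= (1 - alpha) * (e / 2).
    by rewrite (le_trans (ler_norm _))// HN// leq_addr.
  rewrite addnS /= exprS -mulrA.
  move: (ler_wpM2l (ltW a0) IH) tN; lra.
have [N' HN'] := geometric_null `|majorant r0 t N| e20.
exists (N + N')%N => m Nm.
have -> : m = (N + (m - N))%N by rewrite subnKC// (leq_trans _ Nm)// leq_addr.
rewrite (le_trans (key _))// [leRHS]splitr lerD2r HN'//.
by rewrite leq_subRL ?(leq_trans _ Nm)// leq_addr.
Qed.

Lemma forward_bound f g s (b : R) :
  (forall m j (x : 'cV[R]_d), `|fwd_prod f m j *m x| <= C * alpha ^+ j * `|x|) ->
  (forall m, s m.+1 = f m *m s m + g m) ->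
  `|s 0%N| <= b -> (forall m, `|g m| <= b) ->
  forall m, `|s m| <= C * b / (1 - alpha).
Proof.
move=> fC sE sb gb m; apply: le_trans (forward_majorant fC sE m) _.
have b0 : 0 <= b by exact: le_trans (normr_ge0 _) sb.
by apply: majorant_le => [||i]; rewrite ?mulr_ge0// ler_wpM2l.
Qed.

Lemma nullseqM (V : normedZmodType R) (g : nat -> V) :
  nullseq g -> nullseq (fun m => C * `|g m|).
Proof.
move=> gn e e0.
have [|N HN] := gn (e / (C + 1)); first by rewrite divr_gt0// ltr_wpDl.
exists N => m /HN gm; rewrite normrM normr_id ger0_norm//.
rewrite (le_trans (ler_wpM2l C0 gm))//.
have C1 : 0 < C + 1 by rewrite ltr_wpDl.
by rewrite mulrCA ler_piMr//; [exact: ltW|rewrite ler_pdivrMr// mul1r lerDl].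
Qed.

Lemma forward_null f g s :
  (forall m j (x : 'cV[R]_d), `|fwd_prod f m j *m x| <= C * alpha ^+ j * `|x|) ->
  (forall m, s m.+1 = f m *m s m + g m) -> nullseq g -> nullseq s.
Proof.
move=> fC sE gn e e0.
have tn : nullseq (fun m => C * `|g m|) by exact: nullseqM.
have [|N HN] := majorant_null (C * `|s 0%N|) _ tn e0.
  by move=> m; rewrite mulr_ge0.
by exists N => m /HN; apply: le_trans; exact: forward_majorant.
Qed.

Lemma sum_geometric_le (b : R) N : 0 <= b ->
  \sum_(i < N) b * alpha ^+ i <= b / (1 - alpha).
Proof.
move=> b0; rewrite -mulr_sumr ler_wpM2l//.
have -> : \sum_(i < N) alpha ^+ i = (1 - alpha ^+ N) / (1 - alpha).
  rewrite -opprB subrX1 -mulNr opprB mulrC mulKf// gt_eqF//.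
rewrite ler_pdivrMr// mulVf ?gt_eqF// gerBl exprn_ge0// ltW//.
Qed.

Lemma backward_unfold h g u :
  (forall m, u m = h m *m u m.+1 + g m) ->
  forall N m, u m = bwd_prod h m N *m u (m + N)%N
                   + \sum_(i < N) bwd_prod h m i *m g (m + i)%N.
Proof.
move=> uE; elim=> [|N IH] m; first by rewrite big_ord0 addn0 mul1mx addr0.
rewrite uE {1}IH mulmxDr mulmxA addSnnS -addrA; congr (_ + _).
rewrite big_ord_recl /= mul1mx addn0 addrC; congr (_ + _).
rewrite mulmx_sumr; apply: eq_bigr => i _.
by rewrite mulmxA /= addSnnS.
Qed.

Lemma bprod_sum_le h g (b : R) :
  (forall m j (x : 'cV[R]_d), `|bwd_prod h m j *m x| <= C * alpha ^+ j * `|x|) ->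
  0 <= b -> forall m, (forall i, `|g (m + i)%N| <= b) -> forall N,
  `|\sum_(i < N) bwd_prod h m i *m g (m + i)%N| <= C * b / (1 - alpha).
Proof.
move=> hC b0 m gb N; rewrite (le_trans (ler_norm_sum _ _ _))//.
apply: le_trans (sum_geometric_le N (mulr_ge0 C0 b0)).
apply: ler_sum => i _; rewrite (le_trans (hC _ _ _))// mulrAC.
by rewrite ler_wpM2r ?exprn_ge0 ?(ltW a0)// ler_wpM2l.
Qed.

(** The rough bound [B] drops out: it enters only through the remainder of [backward_unfold], at
    most [C * alpha ^+ N * B], and [N] is arbitrary. *)
Lemma backward_bound h g u (b B : R) :
  (forall m j (x : 'cV[R]_d), `|bwd_prod h m j *m x| <= C * alpha ^+ j * `|x|) ->
  (forall m, u m = h m *m u m.+1 + g m) ->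
  (forall m, `|g m| <= b) -> (forall m, `|u m| <= B) ->
  forall m, `|u m| <= C * b / (1 - alpha).
Proof.
move=> hC uE gb uB m; apply/ler_addgt0Pr => e e0.
have [N /(_ N (leqnn _)) HN] := geometric_null (C * B) e0.
rewrite (backward_unfold uE N m) (le_trans (ler_normD _ _))// addrC.
have b0 : 0 <= b by exact: le_trans (normr_ge0 _) (gb 0%N).
apply: lerD; first exact: bprod_sum_le.
rewrite (le_trans _ HN)// (le_trans (hC _ _ _))//.
by rewrite mulrCA mulrA ler_wpM2l// mulr_ge0// exprn_ge0// ltW.
Qed.

Lemma cvg_geometric_bounded (a : nat -> 'cV[R]_d) (b : R) :
  (forall i, `|a i| <= b * alpha ^+ i) ->
  exists l : 'cV[R]_d, (\sum_(i < N) a i) @[N --> \oo] --> l.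
Proof.
move=> ab.
have ca k : cvgn (series (fun i => a i k 0) : R^nat).
  apply: (@normed_cvg R R^o); apply: (@series_le_cvg _ _ (geometric b alpha)).
  - by move=> n; exact: normr_ge0.
  - by move=> n /=; exact: le_trans (normr_ge0 _) (ab n).
  - by move=> n /=; exact: le_trans (mx_coord_le _ _ _) (ab n).
  - by apply: is_cvg_geometric_series; rewrite gtr0_norm.
exists (\col_k lim (series (fun i => a i k 0) @ \oo)).
apply/cvg_mxP => k j; rewrite mxE.
have -> : (fun N => (\sum_(i < N) a i) k j) = series (fun i => a i k 0).
  by apply/funext => N; rewrite /series /= summxE ord1 big_mkord.
exact: ca.
Qed.

(** The solution is the series left by [backward_unfold] when the remainder is discarded. It tends
    to 0 because [u m] only sees [g] from index [m] on. *)
Lemma backward_exists h g :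
  (forall m j (x : 'cV[R]_d), `|bwd_prod h m j *m x| <= C * alpha ^+ j * `|x|) ->
  (exists b, forall m, `|g m| <= b) -> nullseq g ->
  exists u, (forall m, u m = h m *m u m.+1 + g m) /\ nullseq u.
Proof.
move=> hC [b gb] gn.
have b0 : 0 <= b by exact: le_trans (normr_ge0 _) (gb 0%N).
have /choice [u Hu] : forall m, exists l : 'cV[R]_d,
    (\sum_(i < N) bwd_prod h m i *m g (m + i)%N) @[N --> \oo] --> l.
  move=> m; apply: (@cvg_geometric_bounded (fun i => bwd_prod h m i *m g (m + i)%N) (C * b)) => i.
  rewrite (le_trans (hC _ _ _))// mulrAC.
  by rewrite ler_wpM2r ?exprn_ge0 ?(ltW a0)// ler_wpM2l.
exists u; split=> [m|].
  (* Two limits of one sequence of partial sums: read as a shift, and with its first term split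
     off. *)
  have H1 : (\sum_(i < N.+1) bwd_prod h m i *m g (m + i)%N) @[N --> \oo] --> u m.
    rewrite (@cvg_shiftS _ (fun N : nat => \sum_(i < N) bwd_prod h m i *m g (m + i)%N)).
    exact: Hu.
  have H2 : (\sum_(i < N.+1) bwd_prod h m i *m g (m + i)%N) @[N --> \oo]
      --> h m *m u m.+1 + g m.
    rewrite (_ : (fun N => _) = fun N : nat =>
      h m *m (\sum_(i < N) bwd_prod h m.+1 i *m g (m.+1 + i)%N) + g m).
      apply: cvgD; last exact: cvg_cst.
      by apply: cvg_mulmx; [exact: cvg_cst|exact: Hu].
    apply/funext => N; rewrite big_ord_recl /= mul1mx addn0 addrC; congr (_ + _).
    by rewrite mulmx_sumr; apply: eq_bigr => i _; rewrite mulmxA /= addSnnS.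
  exact: (cvg_unique (@norm_hausdorff _ _) H1 H2).
(* [e1] makes the tail bound [C * e1 / (1 - alpha)] at most [e / 2], with [C + 1] in place of a
   possibly zero [C]; the other half pays for replacing [u m] by a partial sum. *)
move=> e e0; pose e1 := (e / 2) * (1 - alpha) / (C + 1).
have C1 : 0 < C + 1 by rewrite ltr_wpDl.
have e20 : 0 < e / 2 by rewrite divr_gt0.
have e10 : 0 < e1 by rewrite divr_gt0// mulr_gt0.
have [N HN] := gn e1 e10; exists N => m Nm.
have /cvgrPdist_le/(_ _ e20)[N1 _ /(_ N1 (leqnn _)) HN1] := Hu m.
rewrite -(subrK (\sum_(i < N1) bwd_prod h m i *m g (m + i)%N) (u m)).
rewrite (le_trans (ler_normD _ _))// [leRHS]splitr lerD//.
apply: le_trans (bprod_sum_le hC (ltW e10) _ _) _.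
  by move=> i; apply: HN; rewrite (leq_trans Nm)// leq_addr.
rewrite ler_pdivrMr// /e1 mulrCA ler_piMr//; first by rewrite mulr_ge0// ltW.
by rewrite ler_pdivrMr// mul1r lerDl.
Qed.

End Recursions.

(** * Inhomogeneous equations on half-lines with a dichotomy *)

Section HalfLines.
Variables (R : realType) (d : nat).
Implicit Types (B P : int -> 'M[R]_d).

(** [Phi] is defined by splitting off its last factor in time; the forward half-line needs the first
    one split off. *)
Lemma PhiSr B n m : Phi B n m.+1 = Phi B (n + 1) m *m B n.
Proof.
elim: m => [|m IH]; first by rewrite /= addr0 mulmx1 mul1mx.
rewrite [LHS]/= -/(Phi B n m.+1) IH mulmxA /=.
by congr (B _ *m _ *m _); lia.
Qed.

Lemma matrix_mulP m n (A A' : 'M[R]_(m, n)) :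
  (forall x : 'cV_n, A *m x = A' *m x) -> A = A'.
Proof.
move=> H; apply/matrixP => i j.
by have /matrixP/(_ i 0) := H (delta_mx j 0); rewrite -!colE !mxE.
Qed.

(** Regularity as matrix identities: [c] is the inverse of [b] between the kernels, extended by 0 on
    the image of [p']. It is built column by column from preimages of the columns of [1 - p']. *)
Lemma inverse_on_kernel (b p p' : 'M[R]_d) :
  p *m p = p -> p' *m p' = p' -> b *m p = p' *m b ->
  (forall x : 'cV_d, p *m x = 0 -> b *m x = 0 -> x = 0) ->
  (forall y : 'cV_d, p' *m y = 0 -> exists2 x, p *m x = 0 & b *m x = y) ->
  exists c : 'M[R]_d, [/\ p *m c = 0, c *m p' = 0,
    b *m c = 1%:M - p' & c *m b = 1%:M - p].
Proof.
move=> pp pp' bp inj surj.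
have /choice [c Hc] : forall j, exists x : 'cV[R]_d,
    p *m x = 0 /\ b *m x = col j (1%:M - p').
  move=> j; have [|x px bx] := surj (col j (1%:M - p')).
    by rewrite colE mulmxA mulmxBr mulmx1 pp' subrr mul0mx.
  by exists x.
pose C := \matrix_(i, j) c j i 0.
have colC j : col j C = c j by apply/colP => i; rewrite !mxE.
have pC : p *m C = 0.
  apply/matrixP => k j; have [/colP/(_ k) + _] := Hc j.
  by rewrite -colC [col j C]colE mulmxA -colE !mxE.
have bC : b *m C = 1%:M - p'.
  apply/matrixP => k j; have [_ /colP/(_ k)] := Hc j.
  by rewrite -colC [col j C]colE mulmxA -colE !mxE.
have inj0 (X : 'M[R]_d) : p *m X = 0 -> b *m X = 0 -> X = 0.
  move=> pX bX; apply: matrix_mulP => x; rewrite mul0mx.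
  by apply: inj; rewrite mulmxA ?pX ?bX mul0mx.
exists C; split=> //.
- by apply: inj0; rewrite mulmxA ?pC ?bC ?mul0mx// mulmxBl mul1mx pp' subrr.
- apply/eqP; rewrite -subr_eq0; apply/eqP; apply: inj0.
    by rewrite mulmxBr mulmxA pC mul0mx mulmxBr mulmx1 pp subrr subrr.
  by rewrite !mulmxBr mulmxA bC mulmxBl mul1mx mulmx1 bp subrr.
Qed.

(** The factor [d%:R] comes from the entrywise maximum norm; the summand 1 lets one constant serve
    both complementary projections. *)
Lemma proj_norm_le (p : 'M[R]_d) (M : R) (x : 'cV[R]_d) : `|p| <= M ->
  `|p *m x| <= (1 + d%:R * M) * `|x| /\ `|(1%:M - p) *m x| <= (1 + d%:R * M) * `|x|.
Proof.
move=> pM.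
have pxM : `|p *m x| <= d%:R * M * `|x|.
  by rewrite (le_trans (mulmx_norm_le _ _))// ler_wpM2r// ler_wpM2l.
split; first by rewrite (le_trans pxM)// mulrDl mul1r lerDr.
by rewrite mulmxBl mul1mx (le_trans (ler_normB _ _))// mulrDl mul1r lerD2l.
Qed.

Section Constants.
Variables (K alpha M : R).
Hypotheses (K1 : 1 <= K) (a0 : 0 < alpha) (a1 : alpha < 1) (M0 : 0 <= M).

(** The dichotomy constant times the bound of either projection. Being at least 1, it also covers
    the empty product. *)
Let C := K * (1 + d%:R * M).

Let C1 : 1 <= C.
Proof. by rewrite /C mulr_ege1// lerDl mulr_ge0. Qed.

Let C0 : 0 <= C. Proof. exact: le_trans C1. Qed.

Let K0 : 0 < K. Proof. exact: lt_le_trans K1. Qed.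

Let contract_stable (F p : 'M[R]_d) (j : nat) : `|p| <= M ->
  (forall x : 'cV[R]_d, `|F *m (p *m x)| <= K * alpha ^+ j * `|p *m x|) ->
  forall x : 'cV[R]_d, `|F *m (p *m x)| <= C * alpha ^+ j * `|x|.
Proof.
move=> pM Fp x; rewrite (le_trans (Fp x))// /C mulrAC -mulrA.
rewrite -[leRHS]mulrA (mulrC (alpha ^+ j)) -mulrA ler_wpM2l ?(ltW K0)// mulrA.
by rewrite ler_wpM2r ?exprn_ge0 ?(ltW a0)//; have [] := proj_norm_le x pM.
Qed.

(** The lower estimate is applied to [c x], which lies in [ker p] and is sent by [F] to
    [(1 - p') x]; inverted, expansion forward becomes contraction of the backward map. *)
Let contract_unstable (F c p p' : 'M[R]_d) (j : nat) : `|p'| <= M ->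
  p *m c = 0 -> F *m c = 1%:M - p' ->
  (forall x : 'cV[R]_d, K^-1 * alpha ^- j * `|(1%:M - p) *m x| <= `|F *m ((1%:M - p) *m x)|) ->
  forall x : 'cV[R]_d, `|c *m x| <= C * alpha ^+ j * `|x|.
Proof.
move=> pM pc Fc Fp x.
have := Fp (c *m x); rewrite [X in `|X|]mulmxA mulmxBl pc subr0 mul1mx.
rewrite (mulmxA (1%:M - p)) mulmxBl pc subr0 mul1mx mulmxA Fc => H.
have {}H : `|c *m x| <= K * alpha ^+ j * `|(1%:M - p') *m x|.
  move: H; rewrite -invfM mulrC ler_pdivrMr; first by rewrite mulrC.
  by rewrite mulr_gt0// exprn_gt0.
rewrite (le_trans H)// /C mulrAC -mulrA.
rewrite -[leRHS]mulrA (mulrC (alpha ^+ j)) -mulrA ler_wpM2l ?(ltW K0)// mulrA.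
by rewrite ler_wpM2r ?exprn_ge0 ?(ltW a0)//; have [] := proj_norm_le x pM.
Qed.

Let unit_bound (x : 'cV[R]_d) : `|1%:M *m x| <= C * alpha ^+ 0 * `|x|.
Proof. by rewrite mul1mx expr0 mulr1 ler_peMl. Qed.

Section Plus.
Variables (b p c : nat -> 'M[R]_d).
Variable F : nat -> nat -> 'M[R]_d.
Hypotheses (pp : forall m, p m *m p m = p m)
  (pM : forall m, `|p m| <= M)
  (bp : forall m, b m *m p m = p m.+1 *m b m)
  (pc : forall m, p m *m c m = 0)
  (cp : forall m, c m *m p m.+1 = 0)
  (bc : forall m, b m *m c m = 1%:M - p m.+1)
  (cb : forall m, c m *m b m = 1%:M - p m)
  (F0 : forall m, F m 0 = 1%:M)
  (FS : forall m j, F m j.+1 = F m.+1 j *m b m)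
  (est1 : forall m j (x : 'cV[R]_d),
    `|F m j *m (p m *m x)| <= K * alpha ^+ j * `|p m *m x|)
  (est2 : forall m j (x : 'cV[R]_d),
    K^-1 * alpha ^- j * `|(1%:M - p m) *m x| <= `|F m j *m ((1%:M - p m) *m x)|).

(** Composing the step with [p m] makes its products contract on the whole space instead of on
    [im p] alone, as the recursion lemmas demand. *)
Let f m := b m *m p m.

Let fprodE m j : fwd_prod f m j *m p m = F m j *m p m.
Proof.
elim: j m => [|j IH] m /=; first by rewrite F0.
by rewrite /f -2!mulmxA pp bp mulmxA IH -mulmxA -bp mulmxA -FS.
Qed.

Let fprod_bound m j (x : 'cV[R]_d) : `|fwd_prod f m j *m x| <= C * alpha ^+ j * `|x|.
Proof.
case: j => [|j]; first exact: unit_bound.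
have -> : fwd_prod f m j.+1 = F m j.+1 *m p m by rewrite -fprodE /= /f -2!mulmxA pp.
by rewrite -mulmxA; exact: contract_stable.
Qed.

Let bprodq m j : p m *m (bwd_prod c m j *m (1%:M - p (m + j)%N)) = 0.
Proof.
case: j => [|j] /=; last by rewrite 2!mulmxA pc !mul0mx.
by rewrite mul1mx addn0 mulmxBr mulmx1 pp subrr.
Qed.

Let bprodE m j : F m j *m (bwd_prod c m j *m (1%:M - p (m + j)%N)) = 1%:M - p (m + j)%N.
Proof.
elim: j m => [|j IH] m; first by rewrite F0 /= !mul1mx.
rewrite FS /= -[c m *m _ *m _]mulmxA -mulmxA (mulmxA (b m)) bc.
rewrite [(1%:M - _) *m (_ *m _)]mulmxBl mul1mx -addSnnS bprodq subr0.
exact: IH.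
Qed.

Let bprod_bound m j (x : 'cV[R]_d) : `|bwd_prod c m j *m x| <= C * alpha ^+ j * `|x|.
Proof.
case: j => [|j]; first exact: unit_bound.
(* [c] kills the image of the next projector, so [1 - p] may be inserted at the far end, where
   [contract_unstable] expects it. *)
have E : bwd_prod c m j.+1 = bwd_prod c m j.+1 *m (1%:M - p (m + j.+1)%N).
  suff H n i : bwd_prod c n i.+1 *m p (n + i.+1)%N = 0.
    by rewrite mulmxBr mulmx1 H subr0.
  elim: i n => [|i IH] n /=; first by rewrite mulmx1 addn1.
  by rewrite -mulmxA -addSnnS IH mulmx0.
rewrite E; apply: (contract_unstable (pM (m + j.+1))); [exact: bprodq|exact: bprodE|exact: est2].
Qed.

(** The solution is [s + u] with [s] in [im p] run forward from [xi], and [u] in [ker p] obtained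
    backward from infinity. Decay leaves no freedom for [u], so only the stable component can be
    prescribed. *)
Lemma plus_exists (psi : nat -> 'cV[R]_d) (xi : 'cV[R]_d) :
  (exists e, forall m, `|psi m| <= e) -> nullseq psi -> p 0%N *m xi = xi ->
  exists phi : nat -> 'cV[R]_d,
    [/\ forall m, phi m.+1 = b m *m phi m + psi m, p 0%N *m phi 0%N = xi & nullseq phi].
Proof.
move=> psib psin pxi.
have pbnd m (x : 'cV[R]_d) : `|p m *m x| <= C * `|x|.
  have [+ _] := proj_norm_le x (pM m); move=> /le_trans -> //.
  by rewrite ler_wpM2r// /C ler_peMl// addr_ge0// mulr_ge0.
pose s := fix s m := if m is m'.+1 then f m' *m s m' + p m'.+1 *m psi m' else xi.
have sp m : p m *m s m = s m.
  case: m => [|m] /=; first exact: pxi.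
  rewrite mulmxDr /f !mulmxA pp -bp.
  by rewrite -(mulmxA (b m) (p m)) pp.
have sn : nullseq s.
  apply: (forward_null C0 a0 a1 fprod_bound (g := fun m => p m.+1 *m psi m)) => //.
  move=> e e0; have [N HN] := nullseqM C0 psin e0.
  exists N => m /HN; rewrite normrM normr_id ger0_norm//; exact: le_trans.
have cbnd m (x : 'cV[R]_d) : `|c m *m x| <= C * `|x|.
  have := bprod_bound m 1 x; rewrite /= mulmx1 => /le_trans -> //.
  by rewrite ler_wpM2r// ler_piMr// expr1 ltW.
have [|||u [uE un]] := @backward_exists R d C alpha C0 a0 a1 c (fun m => - (c m *m psi m)).
- exact: bprod_bound.
- case: psib => e He; exists (C * e) => m.
  by rewrite normrN (le_trans (cbnd _ _))// ler_wpM2l.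
- move=> e e0; have [N HN] := nullseqM C0 psin e0.
  exists N => m /HN; rewrite normrN normrM normr_id ger0_norm//; exact: le_trans.
have pu m : p m *m u m = 0 by rewrite uE mulmxDr mulmxN !mulmxA pc !mul0mx subrr.
exists (fun m => s m + u m); split.
- move=> m; rewrite mulmxDr [u m]uE mulmxBr !mulmxA bc [s m.+1]/= /f.
  rewrite -(mulmxA (b m)) sp !mulmxBl !mul1mx pu subr0 opprB.
  by rewrite -[RHS]addrA -[X in _ = _ + X]addrA subrK (addrC (u _)) addrA.
- by rewrite mulmxDr pu addr0 pxi.
- move=> e e0; have e20 : 0 < e / 2 by rewrite divr_gt0.
  have [N1 H1] := sn _ e20; have [N2 H2] := un _ e20.
  exists (maxn N1 N2) => m; rewrite geq_max => /andP[/H1 Hs /H2 Hu].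
  by rewrite (le_trans (ler_normD _ _))// [leRHS]splitr lerD.
Qed.

(** Both components of a given solution obey the recursions used for existence. The factor 2 counts
    them, and the inner [C] bounds the projected or pulled-back input; [E] is only needed to start
    [backward_bound]. *)
Lemma plus_bound (psi phi : nat -> 'cV[R]_d) (e E : R) :
  (forall m, phi m.+1 = b m *m phi m + psi m) ->
  (forall m, `|psi m| <= e) -> `|p 0%N *m phi 0%N| <= e -> (forall m, `|phi m| <= E) ->
  forall m, `|phi m| <= 2 * (C * (C * e) / (1 - alpha)).
Proof.
move=> phiE psie pe phib m.
have e0 : 0 <= e by exact: le_trans pe.
have CK : 1 + d%:R * M <= C by rewrite /C ler_peMl// addr_ge0// mulr_ge0.
have pqbnd k (x : 'cV[R]_d) : `|p k *m x| <= C * `|x| /\ `|(1%:M - p k) *m x| <= C * `|x|.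
  have [H1 H2] := proj_norm_le x (pM k).
  by split; [apply: le_trans H1 _|apply: le_trans H2 _]; rewrite ler_wpM2r.
have cbnd k (x : 'cV[R]_d) : `|c k *m x| <= C * `|x|.
  have := bprod_bound k 1 x; rewrite /= mulmx1 => /le_trans -> //.
  by rewrite ler_wpM2r// ler_piMr// expr1 ltW.
have Hs : `|p m *m phi m| <= C * (C * e) / (1 - alpha).
  apply: (@forward_bound R d C alpha C0 a0 a1 f (fun k => p k.+1 *m psi k)
     (fun k => p k *m phi k)) => //.
  - by move=> k; rewrite phiE mulmxDr /f !mulmxA -bp -(mulmxA (b k) (p k) (p k)) pp.
  - by rewrite (le_trans pe)// ler_peMl.
  - by move=> k; have [+ _] := pqbnd k.+1 (psi k); move=> /le_trans -> //; rewrite ler_wpM2l.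
have Hu : `|(1%:M - p m) *m phi m| <= C * (C * e) / (1 - alpha).
  apply: (@backward_bound R d C alpha C0 a0 a1 c (fun k => - (c k *m psi k))
     (fun k => (1%:M - p k) *m phi k) _ (C * E)) => //.
  - move=> k; rewrite phiE mulmxDr mulmxDr !mulmxA mulmxBr mulmx1 cp subr0 cb.
    by rewrite addrK.
  - by move=> k; rewrite normrN (le_trans (cbnd _ _))// ler_wpM2l.
  - by move=> k; have [_] := pqbnd k (phi k); move=> /le_trans -> //; rewrite ler_wpM2l.
rewrite mulr_natl mulr2n.
have -> : phi m = p m *m phi m + (1%:M - p m) *m phi m by rewrite -mulmxDl addrC subrK mul1mx.
by rewrite (le_trans (ler_normD _ _))// lerD.
Qed.

End Plus.

Section Minus.
Variables (b p c : nat -> 'M[R]_d).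
Variable F : nat -> nat -> 'M[R]_d.
Hypotheses (pp : forall m, p m *m p m = p m)
  (pM : forall m, `|p m| <= M)
  (bp : forall m, b m *m p m.+1 = p m *m b m)
  (pc : forall m, p m.+1 *m c m = 0)
  (cp : forall m, c m *m p m = 0)
  (bc : forall m, b m *m c m = 1%:M - p m)
  (cb : forall m, c m *m b m = 1%:M - p m.+1)
  (F0 : forall m, F m 0 = 1%:M)
  (FS : forall m j, F m j.+1 = b m *m F m.+1 j)
  (est1 : forall m j (x : 'cV[R]_d),
    `|F m j *m (p (m + j)%N *m x)| <= K * alpha ^+ j * `|p (m + j)%N *m x|)
  (est2 : forall m j (x : 'cV[R]_d),
    K^-1 * alpha ^- j * `|(1%:M - p (m + j)%N) *m x|
    <= `|F m j *m ((1%:M - p (m + j)%N) *m x)|).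

(** Here [m] counts time downwards, so iteration forward in time is a backward product in [m], and
    the inverses [c] form a forward product. The two kinds of recursion exchange roles with respect
    to the other half-line. *)
Let h m := b m *m p m.+1.

Let bprodp m j : p m *m (bwd_prod h m j *m p (m + j)%N) = bwd_prod h m j *m p (m + j)%N.
Proof.
case: j => [|j] /=; first by rewrite mul1mx addn0.
by rewrite /h !mulmxA -bp -(mulmxA (b m) (p m.+1) (p m.+1)) pp.
Qed.

Let bprodE m j : bwd_prod h m j *m p (m + j)%N = F m j *m p (m + j)%N.
Proof.
elim: j m => [|j IH] m /=; first by rewrite F0.
by rewrite FS -addSnnS -[LHS]mulmxA -[RHS]mulmxA -IH -[in RHS]bprodp [RHS]mulmxA.
Qed.

Let bprod_bound m j (x : 'cV[R]_d) : `|bwd_prod h m j *m x| <= C * alpha ^+ j * `|x|.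
Proof.
case: j => [|j]; first exact: unit_bound.
have -> : bwd_prod h m j.+1 = F m j.+1 *m p (m + j.+1)%N.
  rewrite -bprodE.
  elim: j m => [|j IH] m; first by rewrite /= /h mulmx1 addn1 -mulmxA pp.
  by rewrite [LHS]/= -/(bwd_prod h m.+1 j.+1) {1}IH mulmxA addSnnS.
by rewrite -mulmxA; exact: contract_stable.
Qed.

Let fprodq m j : p (m + j)%N *m (fwd_prod c m j *m (1%:M - p m)) = 0.
Proof.
elim: j m => [|j IH] m /=; first by rewrite mul1mx addn0 mulmxBr mulmx1 pp subrr.
rewrite -addSnnS; have -> : c m = (1%:M - p m.+1) *m c m by rewrite mulmxBl pc subr0 mul1mx.
by rewrite !mulmxA -(mulmxA (p _)) IH !mul0mx.
Qed.

Let fprodE m j : F m j *m (fwd_prod c m j *m (1%:M - p m)) = 1%:M - p m.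
Proof.
elim: j m => [|j IH] m; first by rewrite F0 /= !mul1mx.
rewrite FS /=; have -> : c m = (1%:M - p m.+1) *m c m by rewrite mulmxBl pc subr0 mul1mx.
rewrite -!mulmxA (mulmxA (F _ _)) (mulmxA _ (1%:M - p m.+1)) -(mulmxA (F _ _)) IH.
rewrite (mulmxA (1%:M - p m.+1)) mulmxBl pc subr0 mul1mx mulmxA bc.
by rewrite mulmxBl mul1mx mulmxBr mulmx1 pp subrr subr0.
Qed.

Let fprod_bound m j (x : 'cV[R]_d) : `|fwd_prod c m j *m x| <= C * alpha ^+ j * `|x|.
Proof.
case: j => [|j]; first exact: unit_bound.
have E : fwd_prod c m j.+1 = fwd_prod c m j.+1 *m (1%:M - p m).
  by rewrite /= mulmxBr mulmx1 -mulmxA cp mulmx0 subr0.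
rewrite E; apply: (contract_unstable (pM m)); [exact: fprodq|exact: fprodE|exact: est2].
Qed.

Lemma minus_exists (psi : nat -> 'cV[R]_d) (eta : 'cV[R]_d) :
  (exists e, forall m, `|psi m| <= e) -> nullseq psi -> p 0%N *m eta = 0 ->
  exists phi : nat -> 'cV[R]_d,
    [/\ forall m, phi m = b m *m phi m.+1 + psi m,
        (1%:M - p 0%N) *m phi 0%N = eta & nullseq phi].
Proof.
move=> psib psin peta.
have pbnd m (x : 'cV[R]_d) : `|p m *m x| <= C * `|x|.
  have [+ _] := proj_norm_le x (pM m); move=> /le_trans -> //.
  by rewrite ler_wpM2r// /C ler_peMl// addr_ge0// mulr_ge0.
have cbnd m (x : 'cV[R]_d) : `|c m *m x| <= C * `|x|.
  have := fprod_bound m 1 x; rewrite /= mul1mx => /le_trans -> //.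
  by rewrite ler_wpM2r// ler_piMr// expr1 ltW.
pose s := fix s m := if m is m'.+1 then c m' *m s m' - c m' *m psi m' else eta.
have sp m : p m *m s m = 0.
  by case: m => [//|m] /=; rewrite mulmxBr !mulmxA pc !mul0mx subrr.
have sn : nullseq s.
  apply: (forward_null C0 a0 a1 fprod_bound (g := fun m => - (c m *m psi m))) => //.
  move=> e e0; have [N HN] := nullseqM C0 psin e0.
  exists N => m /HN; rewrite normrN normrM normr_id ger0_norm//; exact: le_trans.
have [|||u [uE un]] := @backward_exists R d C alpha C0 a0 a1 h (fun m => p m *m psi m).
- exact: bprod_bound.
- case: psib => e He; exists (C * e) => m.
  by rewrite (le_trans (pbnd _ _))// ler_wpM2l.
- move=> e e0; have [N HN] := nullseqM C0 psin e0.
  exists N => m /HN; rewrite normrM normr_id ger0_norm//; exact: le_trans.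
have pu m : p m *m u m = u m.
  by rewrite uE mulmxDr /h !mulmxA pp -bp -(mulmxA (b m) (p m.+1) (p m.+1)) pp.
exists (fun m => s m + u m); split.
- move=> m; rewrite mulmxDr [s m.+1]/= mulmxBr !mulmxA bc [u m]uE /h.
  rewrite -(mulmxA (b m)) pu !mulmxBl !mul1mx sp subr0 opprB.
  rewrite -!addrA; congr (_ + _); rewrite addrC; congr (_ + _).
  by rewrite [RHS]addrC addrK.
- by rewrite mulmxBl mul1mx mulmxDr sp pu add0r addrK.
- move=> e e0; have e20 : 0 < e / 2 by rewrite divr_gt0.
  have [N1 H1] := sn _ e20; have [N2 H2] := un _ e20.
  exists (maxn N1 N2) => m; rewrite geq_max => /andP[/H1 Hs /H2 Hu].
  by rewrite (le_trans (ler_normD _ _))// [leRHS]splitr lerD.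
Qed.

Lemma minus_bound (psi phi : nat -> 'cV[R]_d) (e E : R) :
  (forall m, phi m = b m *m phi m.+1 + psi m) ->
  (forall m, `|psi m| <= e) -> `|(1%:M - p 0%N) *m phi 0%N| <= e ->
  (forall m, `|phi m| <= E) ->
  forall m, `|phi m| <= 2 * (C * (C * e) / (1 - alpha)).
Proof.
move=> phiE psie pe phib m.
have e0 : 0 <= e by exact: le_trans pe.
have CK : 1 + d%:R * M <= C by rewrite /C ler_peMl// addr_ge0// mulr_ge0.
have pqbnd k (x : 'cV[R]_d) : `|p k *m x| <= C * `|x| /\ `|(1%:M - p k) *m x| <= C * `|x|.
  have [H1 H2] := proj_norm_le x (pM k).
  by split; [apply: le_trans H1 _|apply: le_trans H2 _]; rewrite ler_wpM2r.
have cbnd k (x : 'cV[R]_d) : `|c k *m x| <= C * `|x|.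
  have := fprod_bound k 1 x; rewrite /= mul1mx => /le_trans -> //.
  by rewrite ler_wpM2r// ler_piMr// expr1 ltW.
have Hs : `|(1%:M - p m) *m phi m| <= C * (C * e) / (1 - alpha).
  apply: (@forward_bound R d C alpha C0 a0 a1 c (fun k => - (c k *m psi k))
     (fun k => (1%:M - p k) *m phi k)) => //.
  - move=> k; rewrite -cb (mulmxA (c k)) [c k *m (1%:M - p k)]mulmxBr mulmx1 cp subr0.
    by rewrite [phi k]phiE mulmxDr !mulmxA addrK.
  - by rewrite (le_trans pe)// ler_peMl.
  - by move=> k; rewrite normrN (le_trans (cbnd _ _))// ler_wpM2l.
have Hu : `|p m *m phi m| <= C * (C * e) / (1 - alpha).
  apply: (@backward_bound R d C alpha C0 a0 a1 h (fun k => p k *m psi k)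
     (fun k => p k *m phi k) _ (C * E)) => //.
  - by move=> k; rewrite {1}phiE mulmxDr /h !mulmxA -bp -(mulmxA (b k) (p k.+1) (p k.+1)) pp.
  - by move=> k; have [+ _] := pqbnd k (psi k); move=> /le_trans -> //; rewrite ler_wpM2l.
  - by move=> k; have [+ _] := pqbnd k (phi k); move=> /le_trans -> //; rewrite ler_wpM2l.
rewrite mulr_natl mulr2n.
have -> : phi m = p m *m phi m + (1%:M - p m) *m phi m by rewrite -mulmxDl addrC subrK mul1mx.
by rewrite (le_trans (ler_normD _ _))// lerD.
Qed.

End Minus.

End Constants.

End HalfLines.

(** * The equation on the whole line *)

Section Ell0.
Variables (R : realType) (d : nat).
Implicit Types phi psi : int -> 'cV[R]_d.

Lemma ell0_bounded phi : ell0 phi -> exists b, forall n, `|phi n| <= b.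
Proof.
move=> /(_ 1 ltr01)[N HN].
(* The summand 1 bounds the tail; the finite sum dominates each of the remaining values. *)
exists (1 + \sum_(i < N) (`|phi i%:Z| + `|phi (- i%:Z)|)) => n.
have s0 (i : 'I_N) : 0 <= `|phi i%:Z| + `|phi (- i%:Z)| by rewrite addr_ge0.
have [/HN /ltW H|nN] := leP N%:Z `|n|.
  by rewrite (le_trans H)// lerDl sumr_ge0.
have nN' : (`|n|%N < N)%N by lia.
rewrite (bigD1 (Ordinal nN')) //= addrCA.
apply: ler_wpDr; first by rewrite addr_ge0// sumr_ge0.
have [n0|n0] := leP 0 n.
  have -> : (`|n|%N)%:Z = n by lia.
  by rewrite lerDl.
have -> : - (`|n|%N)%:Z = n by lia.
by rewrite lerDr.
Qed.

Lemma ell0P phi :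
  (forall e : R, 0 < e -> exists N : nat, forall n : int, (N%:Z <= `|n|)%R -> `|phi n| <= e) ->
  ell0 phi.
Proof.
move=> H e e0; have [|N HN] := H (e / 2); first by rewrite divr_gt0.
by exists N => n /HN /le_lt_trans; apply; rewrite ltr_pdivrMr// ltr_pMr// ltr1n.
Qed.

Lemma ell0_lin (a : R) phi psi : ell0 phi -> ell0 psi -> ell0 (a *: phi + psi).
Proof.
move=> H1 H2; apply: ell0P => e e0.
have a1 : 0 < 2 * (`|a| + 1) by rewrite mulr_gt0// ltr_wpDl.
have [|N1 HN1] := H1 (e / (2 * (`|a| + 1))); first by rewrite divr_gt0.
have [|N2 HN2] := H2 (e / 2); first by rewrite divr_gt0.
exists (maxn N1 N2) => n Nn.
have /HN1/ltW h1 : (N1%:Z <= `|n|)%R by lia.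
have /HN2/ltW h2 : (N2%:Z <= `|n|)%R by lia.
rewrite fctE (le_trans (ler_normD _ _))// [leRHS]splitr lerD// normrZ.
rewrite (le_trans (ler_wpM2l (normr_ge0 _) h1))// mulrCA ler_wpM2l ?(ltW e0)//.
rewrite ler_pdivrMr// mulrA mulVf// mul1r lerDl//.
Qed.

Lemma ell0_0 : ell0 (0 : int -> 'cV[R]_d).
Proof. by apply: ell0P => e e0; exists 0%N => n _; rewrite [X in `|X|](_ : _ = 0)// normr0 ltW. Qed.

Lemma ell0_add phi psi : ell0 phi -> ell0 psi -> ell0 (phi + psi).
Proof. by move=> H1 H2; rewrite -[phi]scale1r; exact: ell0_lin. Qed.

Lemma ell0_scale (a : R) phi : ell0 phi -> ell0 (a *: phi).
Proof. by move=> H; rewrite -[_ *: _]addr0; apply: ell0_lin => //; exact: ell0_0. Qed.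

Lemma ell0_opp phi : ell0 phi -> ell0 (- phi).
Proof. by rewrite -scaleN1r; exact: ell0_scale. Qed.

Lemma ell0_sub phi psi : ell0 phi -> ell0 psi -> ell0 (phi - psi).
Proof. by move=> H1 /ell0_opp; exact: ell0_add. Qed.

Lemma ell0_sum (J : Type) (r : seq J) (s : J -> int -> 'cV[R]_d) :
  (forall i, ell0 (s i)) -> ell0 (\sum_(i <- r) s i).
Proof. by move=> H; apply: big_ind => //; [exact: ell0_0|exact: ell0_add]. Qed.

Lemma ell0_null_plus phi (k : int) : ell0 phi -> nullseq (fun m : nat => phi (k + m%:Z)).
Proof.
move=> H e /H[N HN]; exists (N + `|k|)%N => m Nm.
by apply/ltW/HN; lia.
Qed.

Lemma ell0_null_minus phi (k : int) : ell0 phi -> nullseq (fun m : nat => phi (k - m%:Z)).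
Proof.
move=> H e /H[N HN]; exists (N + `|k|)%N => m Nm.
by apply/ltW/HN; lia.
Qed.

Lemma supnorm_ge phi n : ell0 phi -> `|phi n| <= supnorm phi.
Proof.
move=> /ell0_bounded[b Hb]; apply: ub_le_sup; last by exists n.
by exists b => _ [m _ <-]; exact: Hb.
Qed.

Lemma supnorm_le phi (b : R) : (forall n, `|phi n| <= b) -> supnorm phi <= b.
Proof.
move=> Hb; apply: ge_sup; first by exists `|phi 0|, 0.
by move=> _ [m _ <-]; exact: Hb.
Qed.

End Ell0.

(** * Dichotomies on half-lines of the integers *)

Section Line.
Variables (R : realType) (d : nat).
Implicit Types (B P : int -> 'M[R]_d) (phi psi : int -> 'cV[R]_d).

Definition dich_est B (I : set int) P (K alpha : R) : Prop :=
  forall (n : int) (m : nat) (x : 'cV[R]_d), I n -> I (n + m%:Z) ->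
      `|Phi B n m *m (P n *m x)| <= K * alpha ^+ m * `|P n *m x| /\
      K^-1 * alpha ^- m * `|(1%:M - P n) *m x| <= `|Phi B n m *m ((1%:M - P n) *m x)|.

Lemma dich_plus B P (k : int) (K alpha : R) :
  1 <= K -> 0 < alpha < 1 -> inv_reg_projector B [set n : int | k <= n] P ->
  dich_est B [set n : int | k <= n] P K alpha ->
  (forall psi xi, ell0 psi -> P k *m xi = xi ->
     exists phi : nat -> 'cV[R]_d,
     [/\ forall m : nat, phi m.+1 = B (k + m%:Z) *m phi m + psi (k + m%:Z),
         P k *m phi 0%N = xi & nullseq phi]) /\
  exists2 C : R, 0 <= C & forall psi phi (e E : R),
    (forall m : nat, phi (k + m%:Z + 1) = B (k + m%:Z) *m phi (k + m%:Z) + psi (k + m%:Z)) ->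
    (forall n, `|psi n| <= e) -> `|P k *m phi k| <= e -> (forall n, `|phi n| <= E) ->
    forall n, k <= n -> `|phi n| <= C * e.
Proof.
move=> K1 /andP[a0 a1] [PP [BP [[M PM] ker]]] est.
have kI (m : nat) : k <= k + m%:Z by lia.
have ES (m : nat) : k + m.+1%:Z = k + m%:Z + 1 by lia.
pose b (m : nat) := B (k + m%:Z); pose p (m : nat) := P (k + m%:Z).
have M0 : 0 <= M by exact: le_trans (normr_ge0 _) (PM _ (kI 0%N)).
have pp m : p m *m p m = p m by exact: PP (kI m).
have pM m : `|p m| <= M by exact: PM (kI m).
have bp m : b m *m p m = p m.+1 *m b m.
  by rewrite /p ES; apply: BP; rewrite /= -?ES; exact: kI.
have /choice [c Hc] : forall m, exists c : 'M[R]_d, [/\ p m *m c = 0, c *m p m.+1 = 0,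
    b m *m c = 1%:M - p m.+1 & c *m b m = 1%:M - p m].
  move=> m; have [||_ [k2 k3]] := ker (k + m%:Z); rewrite /= -?ES; try exact: kI.
  apply: inverse_on_kernel => //; rewrite /p ES => y; exact: k3.
pose F (m j : nat) := Phi B (k + m%:Z) j.
have FS m j : F m j.+1 = F m.+1 j *m b m by rewrite /F PhiSr ES.
have est1 m j (x : 'cV[R]_d) : `|F m j *m (p m *m x)| <= K * alpha ^+ j * `|p m *m x|.
  by have [] := est (k + m%:Z) j x (kI _); first by rewrite /=; lia.
have est2 m j (x : 'cV[R]_d) :
    K^-1 * alpha ^- j * `|(1%:M - p m) *m x| <= `|F m j *m ((1%:M - p m) *m x)|.
  by have [] := est (k + m%:Z) j x (kI _); first by rewrite /=; lia.
have pE : P k = p 0%N by rewrite /p addr0.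
split.
  move=> psi xi psi0 Pxi.
  have [|||phi [H1 H2 H3]] := plus_exists K1 a0 a1 M0 pp pM bp
    (fun m => let: And4 h _ _ _ := Hc m in h) (fun m => let: And4 _ h _ _ := Hc m in h)
    (fun m => let: And4 _ _ h _ := Hc m in h) (fun m => erefl) FS est1 est2
    (psi := fun m => psi (k + m%:Z)) (xi := xi).
  - by have [e He] := ell0_bounded psi0; exists e.
  - exact: ell0_null_plus.
  - by rewrite -pE.
  - by rewrite -pE in H2; exists phi.
eexists; last first.
  move=> psi phi e E phiE psie pe phib n kn.
  have := plus_bound K1 a0 a1 M0 pp pM bp
    (fun m => let: And4 h _ _ _ := Hc m in h) (fun m => let: And4 _ h _ _ := Hc m in h)
    (fun m => let: And4 _ _ h _ := Hc m in h) (fun m => let: And4 _ _ _ h := Hc m in h)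
    (fun m => erefl) FS est1 est2
    (psi := fun m => psi (k + m%:Z)) (phi := fun m => phi (k + m%:Z)) (e := e) (E := E).
  move=> /(_ _ _ _ _ `|n - k|%N).
  have -> : k + `|n - k|%N%:Z = n by lia.
  move=> H; apply: le_trans (H _ _ _ _) _ => //.
  - by move=> m; rewrite ES phiE.
  - by rewrite -pE addr0.
  - set c0 := (K * (1 + _)).
    have -> : 2 * (c0 * (c0 * e) / (1 - alpha)) = 2 * (c0 * c0 / (1 - alpha)) * e by ring.
    exact: lexx.
have a1' : 0 <= 1 - alpha by rewrite subr_ge0 ltW.
by rewrite mulr_ge0// divr_ge0// -expr2 sqr_ge0.
Qed.

Lemma dich_minus B P (k : int) (K alpha : R) :
  1 <= K -> 0 < alpha < 1 -> inv_reg_projector B [set n : int | n <= k] P ->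
  dich_est B [set n : int | n <= k] P K alpha ->
  (forall psi eta, ell0 psi -> P k *m eta = 0 ->
     exists phi : nat -> 'cV[R]_d,
     [/\ forall m : nat, phi m = B (k - m%:Z - 1) *m phi m.+1 + psi (k - m%:Z - 1),
         (1%:M - P k) *m phi 0%N = eta & nullseq phi]) /\
  exists2 C : R, 0 <= C & forall psi phi (e E : R),
    (forall m : nat, phi (k - m%:Z) = B (k - m%:Z - 1) *m phi (k - m%:Z - 1) + psi (k - m%:Z - 1)) ->
    (forall n, `|psi n| <= e) -> `|(1%:M - P k) *m phi k| <= e -> (forall n, `|phi n| <= E) ->
    forall n, n <= k -> `|phi n| <= C * e.
Proof.
move=> K1 /andP[a0 a1] [PP [BP [[M PM] ker]]] est.
have kI (m : nat) : k - m%:Z <= k by lia.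
have ES (m : nat) : k - m.+1%:Z = k - m%:Z - 1 by lia.
pose b (m : nat) := B (k - m%:Z - 1); pose p (m : nat) := P (k - m%:Z).
have M0 : 0 <= M by exact: le_trans (normr_ge0 _) (PM _ (kI 0%N)).
have pp m : p m *m p m = p m by exact: PP (kI m).
have pM m : `|p m| <= M by exact: PM (kI m).
have bp m : b m *m p m.+1 = p m *m b m.
  have := BP (k - m.+1%:Z); rewrite /= /b /p -ES.
  have -> : k - m.+1%:Z + 1 = k - m%:Z by lia.
  by apply; exact: kI.
have /choice [c Hc] : forall m, exists c : 'M[R]_d, [/\ p m.+1 *m c = 0, c *m p m = 0,
    b m *m c = 1%:M - p m & c *m b m = 1%:M - p m.+1].
  move=> m; have := ker (k - m.+1%:Z); rewrite /=.
  have -> : k - m.+1%:Z + 1 = k - m%:Z by lia.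
  move=> /(_ (kI _) (kI _))[_ [k2 k3]].
  by apply: inverse_on_kernel => //; rewrite /b -ES.
pose F (m j : nat) := Phi B (k - (m + j)%N%:Z) j.
have F0 m : F m 0%N = 1%:M by [].
have FS m j : F m j.+1 = b m *m F m.+1 j.
  by rewrite /F /= addSnnS /b; congr (B _ *m _); lia.
have est1 m j (x : 'cV[R]_d) :
    `|F m j *m (p (m + j)%N *m x)| <= K * alpha ^+ j * `|p (m + j)%N *m x|.
  by have [] := est (k - (m + j)%N%:Z) j x (kI _); first by rewrite /=; lia.
have est2 m j (x : 'cV[R]_d) : K^-1 * alpha ^- j * `|(1%:M - p (m + j)%N) *m x|
    <= `|F m j *m ((1%:M - p (m + j)%N) *m x)|.
  by have [] := est (k - (m + j)%N%:Z) j x (kI _); first by rewrite /=; lia.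
have pE : P k = p 0%N by rewrite /p subr0.
split.
  move=> psi eta psi0 Peta.
  have [|||phi [H1 H2 H3]] := minus_exists K1 a0 a1 M0 pp pM bp
    (fun m => let: And4 h _ _ _ := Hc m in h) (fun m => let: And4 _ h _ _ := Hc m in h)
    (fun m => let: And4 _ _ h _ := Hc m in h) F0 FS est1 est2
    (psi := fun m => psi (k - m%:Z - 1)) (eta := eta).
  - by have [e He] := ell0_bounded psi0; exists e.
  - move=> e e0; have [N HN] := ell0_null_minus (k - 1) psi0 e0.
    by exists N => m /HN; rewrite addrAC.
  - by rewrite -pE.
  - by rewrite -pE in H2; exists phi.
eexists; last first.
  move=> psi phi e E phiE psie pe phib n kn.
  have := minus_bound K1 a0 a1 M0 pp pM bp
    (fun m => let: And4 h _ _ _ := Hc m in h) (fun m => let: And4 _ h _ _ := Hc m in h)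
    (fun m => let: And4 _ _ h _ := Hc m in h) (fun m => let: And4 _ _ _ h := Hc m in h)
    F0 FS est1 est2
    (psi := fun m => psi (k - m%:Z - 1)) (phi := fun m => phi (k - m%:Z)) (e := e) (E := E).
  move=> /(_ _ _ _ _ `|k - n|%N).
  have -> : k - `|k - n|%N%:Z = n by lia.
  move=> H; apply: le_trans (H _ _ _ _) _ => //.
  - by move=> m; rewrite ES phiE.
  - by rewrite -pE subr0.
  - set c0 := (K * (1 + _)).
    have -> : 2 * (c0 * (c0 * e) / (1 - alpha)) = 2 * (c0 * c0 / (1 - alpha)) * e by ring.
    exact: lexx.
have a1' : 0 <= 1 - alpha by rewrite subr_ge0 ltW.
by rewrite mulr_ge0// divr_ge0// -expr2 sqr_ge0.
Qed.

End Line.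

(** * Gluing the half-lines across the gap *)

Section WholeLine.
Variables (R : realType) (d : nat).
Implicit Types (B P : int -> 'M[R]_d) (phi psi : int -> 'cV[R]_d).

Definition dirac_seq (k : int) (w : 'cV[R]_d) : int -> 'cV[R]_d :=
  fun n => if n == k then w else 0.

Lemma dirac_seq_ell0 k w : ell0 (dirac_seq k w).
Proof.
apply: ell0P => e e0; exists `|k|.+1 => n kn.
rewrite /dirac_seq ifF ?normr0 ?ltW//; apply/negbTE/eqP; lia.
Qed.

Lemma dirac_seq_lin k (a : R) w w' :
  dirac_seq k (a *: w + w') = a *: dirac_seq k w + dirac_seq k w'.
Proof.
apply/funext => n.
rewrite -[RHS]/(a *: dirac_seq k w n + dirac_seq k w' n) /dirac_seq.
by case: eqP => // _; rewrite scaler0 addr0.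
Qed.

Lemma dirac_seq_le k w n : `|dirac_seq k w n| <= `|w|.
Proof. by rewrite /dirac_seq; case: eqP => // _; rewrite normr0. Qed.

Variables (B Pp Pm : int -> 'M[R]_d) (kup klo : int) (K alpha K' alpha' : R).
Hypotheses (lk : klo < kup)
  (K1 : 1 <= K) (a1 : 0 < alpha < 1)
  (invp : inv_reg_projector B [set n : int | kup <= n] Pp)
  (estp : dich_est B [set n : int | kup <= n] Pp K alpha)
  (K1' : 1 <= K') (a1' : 0 < alpha' < 1)
  (invm : inv_reg_projector B [set n : int | n <= klo] Pm)
  (estm : dich_est B [set n : int | n <= klo] Pm K' alpha').

Lemma line_exists psi (xi eta : 'cV[R]_d) : ell0 psi ->
  Pp kup *m xi = xi -> Pm klo *m eta = 0 ->
  exists phi w, [/\ ell0 phi,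
    forall n : int, phi (n + 1) - B n *m phi n + dirac_seq (kup - 1) w n = psi n,
    Pp kup *m phi kup = xi & (1%:M - Pm klo) *m phi klo = eta].
Proof.
move=> psi0 Pxi Peta.
have [/(_ _ _ psi0 Pxi)[fp [fpE fp0 fpn]] _] := dich_plus K1 a1 invp estp.
have [/(_ _ _ psi0 Peta)[fm [fmE fm0 fmn]] _] := dich_minus K1' a1' invm estm.
(* [mid] starts from the value at [klo], so it agrees there with the left half-line; the equation
   can only fail on arrival at [kup]. *)
pose mid := fix mid (j : nat) := if j is j'.+1 then
  B (klo + j'%:Z) *m mid j' + psi (klo + j'%:Z) else fm 0%N.
pose phi (n : int) := if kup <= n then fp (absz (n - kup)%R) else
  if n <= klo then fm (absz (klo - n)%R) else mid (absz (n - klo)%R).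
have phip (n : int) : kup <= n -> phi n = fp (absz (n - kup)%R) by rewrite /phi => ->.
have phim (n : int) : n <= klo -> phi n = fm (absz (klo - n)%R).
  by move=> nk; rewrite /phi nk ifF//; apply/negbTE; rewrite -ltNge; lia.
have phimid (n : int) : klo <= n < kup -> phi n = mid (absz (n - klo)%R).
  move=> /andP[n1 n2]; rewrite /phi ifF; last by apply/negbTE; rewrite -ltNge.
  case: ifPn => // nk; have -> : n = klo by lia.
  by rewrite subrr.
(* The jump is the residual of the equation at [kup - 1], where [mid] meets the right half-line. *)
exists phi, (psi (kup - 1) - phi kup + B (kup - 1) *m phi (kup - 1)); split.
- apply: ell0P => e e0.
  have [N1 H1] := fpn e e0; have [N2 H2] := fmn e e0.
  exists (N1 + N2 + `|kup| + `|klo|)%N => n Hn.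
  have [n0|n0] := leP 0 n.
    by rewrite phip ?H1//; lia.
  by rewrite phim ?H2//; lia.
- move=> n; rewrite /dirac_seq; case: eqP => [->|nk].
    by rewrite [kup - 1 + 1]subrK addrCA !subrK.
  rewrite addr0; have [kn|nk'] := leP kup n.
    rewrite !phip ?(le_trans kn) ?lerDl//.
    have -> : absz (n + 1 - kup)%R = (absz (n - kup)%R).+1 by lia.
    rewrite fpE; have -> : kup + (absz (n - kup)%R)%:Z = n by lia.
    by rewrite addrC addKr.
  have [kn|kn] := leP klo n.
    rewrite !phimid ?kn//; last by lia.
    have -> : absz (n + 1 - klo)%R = (absz (n - klo)%R).+1 by lia.
    rewrite /=; have -> : klo + (absz (n - klo)%R)%:Z = n by lia.
    by rewrite addrC addKr.
  rewrite !phim; try lia.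
  rewrite fmE.
  have -> : absz (klo - n)%R = (absz (klo - (n + 1))%R).+1 by lia.
  have -> : klo - (absz (klo - (n + 1))%R)%:Z - 1 = n by lia.
  by rewrite addrC addKr.
- by rewrite phip// subrr.
- by rewrite phim// subrr.
Qed.

(** The left half-line is controlled by its dichotomy and the gap by finitely many forward steps;
    the right half-line has its own dichotomy, independent of the jump. Then [w] is read off from
    the equation at [kup - 1]. *)
Lemma line_bound : exists2 C : R, 0 < C & forall phi w (e : R), ell0 phi ->
  (forall n : int, `|phi (n + 1) - B n *m phi n + dirac_seq (kup - 1) w n| <= e) ->
  `|Pp kup *m phi kup| <= e -> `|(1%:M - Pm klo) *m phi klo| <= e ->
  (forall n, `|phi n| <= C * e) /\ `|w| <= C * e.
Proof.
have [_ [C1 C10 H1]] := dich_plus K1 a1 invp estp.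
have [_ [C2 C20 H2]] := dich_minus K1' a1' invm estm.
have [C3 C30 H3] : exists2 C3 : R, 0 <= C3 & forall phi w (e : R), ell0 phi ->
    (forall n : int, `|phi (n + 1) - B n *m phi n + dirac_seq (kup - 1) w n| <= e) ->
    `|(1%:M - Pm klo) *m phi klo| <= e ->
    forall n, n < kup -> `|phi n| <= C3 * e.
  (* Induction on the number of steps taken into the gap. The condition [n < kup] keeps the jump out
     of every equation used. *)
  suff H J : exists2 C3 : R, 0 <= C3 & forall phi w (e : R), ell0 phi ->
    (forall n : int, `|phi (n + 1) - B n *m phi n + dirac_seq (kup - 1) w n| <= e) ->
    `|(1%:M - Pm klo) *m phi klo| <= e ->
    forall n, n < kup -> n <= klo + J%:Z -> `|phi n| <= C3 * e.
    have [C3 C30 H3] := H (absz (kup - klo)%R); exists C3 => // phi w e p0 p1 p2 n nk.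
    by apply: H3 => //; move: nk; clear; lia.
  elim: J => [|J [C3 C30 IH]].
    exists C2 => // phi w e p0 p1 p2 n nk; rewrite addr0.
    have [E HE] := ell0_bounded p0.
    apply: (H2 (fun n => phi (n + 1) - B n *m phi n + dirac_seq (kup - 1) w n) phi e E) => // m.
    rewrite subrK.
    have -> : dirac_seq (kup - 1) w (klo - m%:Z - 1) = 0.
      by rewrite /dirac_seq; case: eqP => //; move: lk; clear; lia.
    by rewrite addr0 [RHS]addrC subrK.
  pose D := d%:R * `|B (klo + J%:Z)|.
  have D0 : 0 <= D by rewrite mulr_ge0.
  (* [C3] for the points already reached, [D * C3 + 1] for one more step with residual at most
     [e]. *)
  exists (C3 + D * C3 + 1).
    by rewrite !addr_ge0// mulr_ge0.
  move=> phi w e p0 p1 p2 n nk nJ.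
  have e0 : 0 <= e by exact: le_trans p2.
  have := IH phi w e p0 p1 p2; set b := klo + J%:Z => IHn.
  have [nb|nb] := leP n b.
    rewrite (le_trans (IHn _ nk nb))// ler_wpM2r// -addrA lerDl addr_ge0// mulr_ge0//.
  have nE : n = b + 1 by move: nb nJ; rewrite /b; clear; lia.
  have Hb : `|phi b| <= C3 * e by apply: IHn => //; move: nk; rewrite nE; clear; lia.
  have := p1 b; rewrite -nE.
  have -> : dirac_seq (kup - 1) w b = 0.
    by rewrite /dirac_seq; case: eqP => //; move: nk; rewrite nE; clear; lia.
  rewrite addr0 => Hd.
  have HD : `|B b *m phi b| <= D * (C3 * e).
    by rewrite (le_trans (mulmx_norm_le _ _))// ler_wpM2l.
  rewrite -(subrK (B b *m phi b) (phi n)) (le_trans (ler_normD _ _))//.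
  rewrite (le_trans (lerD Hd HD))// addrC !mulrDl mul1r lerD2r mulrA lerDr.
  by rewrite mulr_ge0.
pose D := d%:R * `|B (kup - 1)|.
have D0 : 0 <= D by rewrite mulr_ge0.
have DC : 0 <= D * C3 by rewrite mulr_ge0.
have le1 : C1 <= 1 + C1 + C3 + D * C3 by lra.
have le3 : C3 <= 1 + C1 + C3 + D * C3 by lra.
(* [C1] and [C3] serve the two sides of [kup]; [1 + C1 + D * C3] comes from solving the equation at
   [kup - 1] for [w]. *)
exists (1 + C1 + C3 + D * C3).
  by rewrite -!addrA ltr_wpDr// !addr_ge0// mulr_ge0.
move=> phi w e p0 p1 p2 p3.
have e0 : 0 <= e by exact: le_trans p2.
have [E HE] := ell0_bounded p0.
have Hp (n : int) : kup <= n -> `|phi n| <= C1 * e.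
  apply: (H1 (fun n => phi (n + 1) - B n *m phi n + dirac_seq (kup - 1) w n) phi e E) => // m.
  have -> : dirac_seq (kup - 1) w (kup + m%:Z) = 0.
    by rewrite /dirac_seq; case: eqP => //; clear; lia.
  by rewrite addr0 [RHS]addrC subrK.
have Hm := H3 phi w e p0 p1 p3.
split=> [n|].
  have [/Hp|/Hm] := leP kup n => /le_trans -> //; rewrite ler_wpM2r//.
have HD : `|B (kup - 1) *m phi (kup - 1)| <= D * (C3 * e).
  rewrite (le_trans (mulmx_norm_le _ _))// ler_wpM2l//; apply: Hm; clear; lia.
have := p1 (kup - 1); rewrite /dirac_seq eqxx subrK => Hw.
have -> : w = (phi kup - B (kup - 1) *m phi (kup - 1) + w) - phi kup + B (kup - 1) *m phi (kup - 1).
  by rewrite [RHS]addrAC [X in _ = X - _]addrAC subrK [RHS]addrC addKr.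
rewrite (le_trans (ler_normD _ _))// (le_trans (lerD (ler_normB _ _) HD))//.
rewrite (le_trans (lerD (lerD Hw (Hp _ (lexx _))) (lexx _)))//.
rewrite !mulrDl mul1r mulrA lerD2r lerDl mulr_ge0//.
Qed.

End WholeLine.

(** * Families of operators bordered to isomorphisms *)

Section UniformCvg.
Variables (R : realType) (d : nat).

(** Pointwise bounds avoid [sup], which is informative only for bounded sequences; on [ell0] the two
    notions agree by [ucvg_supnorm]. *)
Definition ucvg (I : Type) (F : set_system I) (g : I -> int -> 'cV[R]_d)
    (gl : int -> 'cV[R]_d) : Prop :=
  forall e : R, 0 < e -> \forall i \near F, forall n, `|g i n - gl n| <= e.

Variables (I : Type) (F : set_system I).
Context {FF : Filter F}.
Implicit Types (g h : I -> int -> 'cV[R]_d).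

Lemma ucvgD g h gl hl : ucvg F g gl -> ucvg F h hl ->
  ucvg F (fun i => g i + h i) (gl + hl).
Proof.
move=> gc hc e e0; have e20 : 0 < e / 2 by rewrite divr_gt0.
near=> i => n; rewrite [leLHS](_ : _ = `|(g i n - gl n) + (h i n - hl n)|); last first.
  by congr `|_|; rewrite !fctE opprD addrACA.
rewrite (le_trans (ler_normD _ _))// [leRHS]splitr lerD//.
  by move: n; near: i; exact: gc.
by move: n; near: i; exact: hc.
Unshelve. all: by end_near. Qed.

Lemma ucvgN g gl : ucvg F g gl -> ucvg F (fun i => - g i) (- gl).
Proof.
move=> gc e e0; apply: filterS (gc e e0) => i H n.
by rewrite !fctE -opprD normrN.
Qed.

Lemma ucvgB g h gl hl : ucvg F g gl -> ucvg F h hl ->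
  ucvg F (fun i => g i - h i) (gl - hl).
Proof. by move=> gc hc; apply: ucvgD gc _; exact: ucvgN. Qed.

Lemma ucvg_cst gl : ucvg F (fun _ => gl) gl.
Proof. by move=> e e0; apply: nearW => i n; rewrite subrr normr0 ltW. Qed.

Lemma ucvg_near g g' gl : (\forall i \near F, g i = g' i) -> ucvg F g' gl -> ucvg F g gl.
Proof. by move=> gg' gc e /gc; apply: filterS2 gg' => i ->. Qed.

Lemma ucvg_supnorm g gl : ell0 gl -> (\forall i \near F, ell0 (g i)) ->
  (ucvg F g gl <-> supnorm (g i - gl) @[i --> F] --> 0).
Proof.
move=> gl0 g0; split=> [gc|/cvgr0Pnorm_le gc e /gc].
  apply/cvgr0Pnorm_le => e e0; near=> i.
  have gi : ell0 (g i - gl) by apply: ell0_sub => //; near: i.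
  rewrite ger0_norm; first by apply: supnorm_le; near: i; exact: gc.
  exact: le_trans (normr_ge0 _) (supnorm_ge 0 gi).
apply: filterS2 g0 => i gi + n; apply: le_trans.
rewrite (le_trans _ (ler_norm _))//.
by have := supnorm_ge n (ell0_sub gi gl0).
Unshelve. all: by end_near. Qed.

Lemma ucvg_comb k (s : 'I_k -> int -> 'cV[R]_d) (c : I -> 'cV[R]_k) (c1 : 'cV[R]_k) :
  (forall j, ell0 (s j)) -> c i @[i --> F] --> c1 ->
  ucvg F (fun i => \sum_j c i j 0 *: s j) (\sum_j c1 j 0 *: s j).
Proof.
move=> s0 cc e e0.
have /choice [b Hb] : forall j, exists b, forall n, `|s j n| <= b.
  by move=> j; exact: ell0_bounded.
have b0 j : 0 <= b j by exact: le_trans (normr_ge0 _) (Hb j 0).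
pose S := \sum_j b j; have S0 : 0 <= S by exact: sumr_ge0.
have S1 : 0 < S + 1 by rewrite ltr_wpDl.
move/cvgrPdist_le: cc => /(_ (e / (S + 1)) (divr_gt0 e0 S1)).
apply: filterS => i ci n; rewrite !fct_sumE -sumrB.
rewrite (le_trans (ler_norm_sum _ _ _))//.
apply: (@le_trans _ _ (\sum_j e / (S + 1) * b j)).
  apply: ler_sum => j _; rewrite !fctE -scalerBl normrZ ler_pM//.
  by rewrite distrC (le_trans _ ci)//; have := mx_coord_le (c1 - c i) j 0; rewrite !mxE.
rewrite -mulr_sumr -/S -mulrA ler_piMr ?(ltW e0)//.
by rewrite mulrC ler_pdivrMr// mul1r lerDl.
Qed.

End UniformCvg.

Section Family.
Variables (R : realType) (d e : nat) (T : pseudoMetricType R).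
Variables (L : T -> (int -> 'cV[R]_d) -> (int -> 'cV[R]_d)).
Variables (dl : 'cV[R]_d -> int -> 'cV[R]_d).
Variables (Pi : T -> 'M[R]_e) (ev : (int -> 'cV[R]_d) -> 'cV[R]_e).

(* [D l (phi, w) = (L l phi + dl w, Pi l (ev phi))] is an isomorphism from
   [ell0 x R^d] onto [ell0 x im (Pi l)], depending continuously on [l]. *)
Record bordered : Prop := Bordered {
  bL_lin : forall l (a : R) phi psi, L l (a *: phi + psi) = a *: L l phi + L l psi;
  bL_ell0 : forall l phi, ell0 phi -> ell0 (L l phi);
  bL_bound : forall l, exists2 C : R, 0 <= C & forall phi b,
    (forall n, `|phi n| <= b) -> forall n, `|L l phi n| <= C * b;
  bL_cont : forall l1 (eps : R), 0 < eps -> exists2 eta : R, 0 < eta &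
    forall l phi b, ball l1 eta l -> (forall n, `|phi n| <= b) ->
      forall n, `|L l phi n - L l1 phi n| <= eps * b;
  bdl_lin : forall (a : R) w w', dl (a *: w + w') = a *: dl w + dl w';
  bdl_ell0 : forall w, ell0 (dl w);
  bdl_le : forall w n, `|dl w n| <= `|w|;
  bPi_proj : forall l, Pi l *m Pi l = Pi l;
  bPi_cont : continuous Pi;
  bev_lin : forall (a : R) phi psi, ev (a *: phi + psi) = a *: ev phi + ev psi;
  bev_le : forall phi b, (forall n, `|phi n| <= b) -> `|ev phi| <= b;
  bD_ex : forall l psi t, ell0 psi -> Pi l *m t = t ->
    exists phi w, [/\ ell0 phi, L l phi + dl w = psi & Pi l *m ev phi = t];
  bD_bound : forall l, exists2 C : R, 0 < C & forall phi w b, ell0 phi ->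
    (forall n, `|(L l phi + dl w) n| <= b) -> `|Pi l *m ev phi| <= b ->
    (forall n, `|phi n| <= C * b) /\ `|w| <= C * b }.

Hypothesis HB : bordered.

Lemma LB l phi psi : L l (phi - psi) = L l phi - L l psi.
Proof.
by have := bL_lin HB l (-1) psi phi; rewrite !scaleN1r addrC => ->; rewrite addrC.
Qed.

Lemma L_zero l : L l 0 = 0.
Proof. by have := LB l 0 0; rewrite subr0 subrr. Qed.

Lemma dlB w w' : dl (w - w') = dl w - dl w'.
Proof.
by have := bdl_lin HB (-1) w' w; rewrite !scaleN1r addrC => ->; rewrite addrC.
Qed.

Lemma dl_zero : dl 0 = 0. Proof. by have := dlB 0 0; rewrite subr0 subrr. Qed.

Lemma evB phi psi : ev (phi - psi) = ev phi - ev psi.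
Proof.
by have := bev_lin HB (-1) psi phi; rewrite !scaleN1r addrC => ->; rewrite addrC.
Qed.

(** Absorption: near [l1] the bordered operator changes by at most [eps * S], where [S] is the norm
    of [phi]. As [C * eps = 1 / 2], the bound at [l1] gives [S <= C * b + S / 2]. Finiteness of [S]
    comes from [ell0 phi]. *)
Lemma D_bound_loc l1 : exists2 C : R, 0 < C & exists2 eta : R, 0 < eta &
  forall l, ball l1 eta l -> forall phi w b, ell0 phi ->
    (forall n, `|(L l phi + dl w) n| <= b) -> `|Pi l *m ev phi| <= b ->
    (forall n, `|phi n| <= C * b) /\ `|w| <= C * b.
Proof.
have [C C0 HC] := bD_bound HB l1.
pose eps := (2 * C)^-1.
have eps0 : 0 < eps by rewrite invr_gt0 mulr_gt0.
have CE : C * eps = 1 / 2 by rewrite /eps invfM; field; rewrite gt_eqF.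
have [eta1 eta10 H1] := bL_cont HB l1 eps0.
(* The divisor [e.+1] cancels the dimension factor of [mulmx_norm_le] and is nonzero even if
   [e = 0]. *)
have eps1 : 0 < eps / e.+1%:R by rewrite divr_gt0.
have := @bPi_cont HB l1 => /cvgrPdist_le/(_ _ eps1).
rewrite -nbhs_ballE => -[eta2 /= eta20 H2].
exists (2 * C); first by rewrite mulr_gt0.
exists (Num.min eta1 eta2); first by rewrite lt_min eta10.
move=> l ll1 phi w b p0 p1 p2.
have bl1 : ball l1 eta1 l by apply: le_ball ll1; rewrite ge_min lexx.
have bl2 : ball l1 eta2 l by apply: le_ball ll1; rewrite ge_min lexx orbT.
set S := supnorm phi.
have HS n : `|phi n| <= S by exact: supnorm_ge.
have S0 : 0 <= S by exact: le_trans (normr_ge0 _) (HS 0).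
have b0 : 0 <= b by exact: le_trans (normr_ge0 _) p2.
have q1 n : `|(L l1 phi + dl w) n| <= b + eps * S.
  rewrite -(subrK ((L l phi + dl w) n) ((L l1 phi + dl w) n)) addrC.
  rewrite (le_trans (ler_normD _ _))// lerD//.
  rewrite [X in `|X|](_ : _ = L l1 phi n - L l phi n); last first.
    by rewrite !fctE opprD addrACA subrr addr0.
  by rewrite distrC; exact: H1.
have q2 : `|Pi l1 *m ev phi| <= b + eps * S.
  rewrite -(subrK (Pi l *m ev phi) (Pi l1 *m ev phi)) addrC.
  rewrite (le_trans (ler_normD _ _))// lerD// -mulmxBl.
  rewrite (le_trans (mulmx_norm_le _ _))// ler_pM ?mulr_ge0//; last exact: bev_le HB _ _ HS.
  rewrite (le_trans (ler_wpM2l _ (H2 _ bl2)))// mulrCA ler_piMr ?(ltW eps0)//.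
  by rewrite ler_pdivrMr// mul1r ler_nat.
have [r1 r2] := HC phi w _ p0 q1 q2.
have CS : C * (b + eps * S) = C * b + S / 2 by rewrite mulrDr mulrA CE mul1r (mulrC 2^-1).
have SC : S <= 2 * C * b.
  have : S <= C * b + S / 2 by rewrite -CS; apply: supnorm_le.
  lra.
split=> [n|]; first exact: le_trans SC.
by rewrite (le_trans r2)// CS; lra.
Qed.

Section Continuity.
Variables (I : Type) (F : set_system I).
Context {FF : Filter F}.
Variables (l : I -> T) (l1 : T).
Hypothesis ll1 : l i @[i --> F] --> l1.

Let near_ball (eta : R) : 0 < eta -> \forall i \near F, ball l1 eta (l i).
Proof. by move=> eta0; apply: ll1; exact: nbhsx_ballx. Qed.

Lemma cvg_L phi phi1 : ell0 phi1 -> ucvg F phi phi1 ->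
  ucvg F (fun i => L (l i) (phi i)) (L l1 phi1).
Proof.
move=> p1 pc eps eps0.
have [b Hb] := ell0_bounded p1.
have b0 : 0 <= b by exact: le_trans (normr_ge0 _) (Hb 0).
have [C C0 HC] := bL_bound HB l1.
have C1 : 0 < C + 1 by rewrite ltr_wpDl.
(* Tolerance 1 suffices for the varying argument: near [l1] the operators are bounded by [C + 1].
   The finer [eta2] handles the fixed [phi1]. *)
have [eta1 eta10 H1] := bL_cont HB l1 ltr01.
have e20 : 0 < eps / 2 by rewrite divr_gt0.
have b1 : 0 < b + 1 by rewrite ltr_wpDl.
have [eta2 eta20 H2] := bL_cont HB l1 (divr_gt0 e20 b1).
near=> i => n.
have bl1 : ball l1 eta1 (l i) by near: i; exact: near_ball.
have bl2 : ball l1 eta2 (l i) by near: i; exact: near_ball.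
set e1 := eps / 2 / (C + 1).
have pe : forall n, `|(phi i - phi1) n| <= e1.
  near: i; apply: pc; exact: divr_gt0.
have -> : L (l i) (phi i) n - L l1 phi1 n =
    (L (l i) (phi i - phi1) n - L l1 (phi i - phi1) n) + L l1 (phi i - phi1) n
    + (L (l i) phi1 n - L l1 phi1 n).
  by rewrite subrK !LB !fctE addrA subrK.
rewrite (le_trans (ler_normD _ _))// [leRHS]splitr lerD//.
  rewrite (le_trans (ler_normD _ _))//.
  rewrite (le_trans (lerD (H1 _ _ _ bl1 pe _) (HC _ _ pe _)))//.
  by rewrite -mulrDl addrC mulrC divfK// gt_eqF.
rewrite (le_trans (H2 _ _ _ bl2 Hb n))// -mulrA ler_piMr ?(ltW e20)//.
by rewrite mulrC ler_pdivrMr// mul1r lerDl.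
Unshelve. all: by end_near. Qed.

Lemma cvg_dl (w : I -> 'cV[R]_d) (w1 : 'cV[R]_d) : w i @[i --> F] --> w1 ->
  ucvg F (fun i => dl (w i)) (dl w1).
Proof.
move=> /cvgrPdistC_le wc eps /wc; apply: filterS => i H n.
by have := bdl_le HB (w i - w1) n; rewrite dlB !fctE => /le_trans; apply.
Qed.

Lemma cvg_ev phi phi1 : ucvg F phi phi1 -> ev (phi i) @[i --> F] --> ev phi1.
Proof.
move=> pc; apply/cvgrPdistC_le => eps /pc; apply: filterS => i H.
by rewrite -evB; exact: bev_le HB _ _ H.
Qed.

Lemma cvg_Pi : Pi (l i) @[i --> F] --> Pi l1.
Proof. exact: cvg_comp ll1 (@bPi_cont HB l1). Qed.

(** Continuity of the inverse: the bordered operator at [l i], applied to the difference from the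
    limit, tends to 0, and [D_bound_loc] is uniform near [l1]. *)
Lemma cvg_D_inv phi w phi1 (w1 : 'cV[R]_d) :
  ell0 phi1 -> (\forall i \near F, ell0 (phi i)) ->
  ucvg F (fun i => L (l i) (phi i) + dl (w i)) (L l1 phi1 + dl w1) ->
  Pi (l i) *m ev (phi i) @[i --> F] --> Pi l1 *m ev phi1 ->
  ucvg F phi phi1 /\ w i @[i --> F] --> w1.
Proof.
move=> p1 p0 Lc Pc.
have [C C0 [eta eta0 HC]] := D_bound_loc l1.
have Lc0 : ucvg F (fun i => L (l i) (phi i - phi1) + dl (w i - w1)) 0.
  have -> : 0 = (L l1 phi1 + dl w1) - (L l1 phi1 + dl w1) by rewrite subrr.
  apply: (@ucvg_near _ _ _ _ _ _ (fun i => (L (l i) (phi i) + dl (w i)) - (L (l i) phi1 + dl w1))).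
    by apply: nearW => i; rewrite LB dlB opprD addrACA.
  apply: ucvgB => //; apply: ucvgD; last exact: ucvg_cst.
  by apply: cvg_L => //; exact: ucvg_cst.
have Pc0 : Pi (l i) *m ev (phi i - phi1) @[i --> F] --> (0 : 'cV[R]_e).
  have -> : 0 = Pi l1 *m ev phi1 - Pi l1 *m ev phi1 by rewrite subrr.
  under eq_fun do rewrite evB mulmxBr.
  by apply: cvgB => //; apply: cvg_mulmx; [exact: cvg_Pi|exact: cvg_cst].
suff H (eps : R) : 0 < eps ->
    \forall i \near F, (forall n, `|phi i n - phi1 n| <= eps) /\ `|w i - w1| <= eps.
  split; first by move=> eps /H; apply: filterS => i [].
  by apply/cvgrPdistC_le => eps /H; apply: filterS => i [].
move=> eps0; have e0 : 0 < eps / C by rewrite divr_gt0.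
near=> i.
have bl : ball l1 eta (l i) by near: i; exact: near_ball.
have pi0 : ell0 (phi i - phi1) by apply: ell0_sub => //; near: i.
have := HC _ bl _ (w i - w1) (eps / C) pi0; rewrite mulrCA divff ?gt_eqF// mulr1.
apply.
- have : forall n, `|(L (l i) (phi i - phi1) + dl (w i - w1)) n - 0| <= eps / C.
    by near: i; exact: Lc0.
  by move=> + n => /(_ n); rewrite subr0.
- by near: i; move/cvgr0Pnorm_le: Pc0; exact.
Unshelve. all: by end_near. Qed.

End Continuity.

Lemma D_inj l phi w phi' w' : ell0 phi -> ell0 phi' ->
  L l phi + dl w = L l phi' + dl w' -> Pi l *m ev phi = Pi l *m ev phi' ->
  phi = phi' /\ w = w'.
Proof.
move=> p p' E1 E2; have [C C0 HC] := bD_bound HB l.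
have [||H1 H2] := HC (phi - phi') (w - w') 0 (ell0_sub p p').
- move=> n; rewrite LB dlB [L l phi - _ + _]addrACA -opprD E1 subrr.
  by rewrite [X in `|X|](_ : _ = 0)// normr0.
- by rewrite evB mulmxBr E2 subrr normr0.
rewrite mulr0 in H1 H2; split.
  apply/funext => n; apply/eqP; rewrite -subr_eq0 -normr_eq0 eq_le normr_ge0 andbT.
  exact: H1.
by apply/eqP; rewrite -subr_eq0 -normr_eq0 eq_le normr_ge0 andbT.
Qed.

Lemma sol_exists (x : T * (int -> 'cV[R]_d) * 'cV[R]_e) :
  exists y : (int -> 'cV[R]_d) * 'cV[R]_d, ell0 x.1.2 ->
    [/\ ell0 y.1, L x.1.1 y.1 + dl y.2 = x.1.2 & Pi x.1.1 *m ev y.1 = Pi x.1.1 *m x.2].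
Proof.
case: x => -[l psi] t /=.
have [p|np] := pselect (ell0 psi); last by exists (0, 0).
have [|phi [w H]] := bD_ex HB (l := l) (t := Pi l *m t) p.
  by rewrite mulmxA (bPi_proj HB).
by exists (phi, w).
Qed.

(** The inverse of the bordered operator. The end values [t] enter only through [Pi l *m t], so the
    data space stays the same as [l] varies. *)
Definition bsol (l : T) (psi : int -> 'cV[R]_d) (t : 'cV[R]_e) :=
  projT1 (cid (sol_exists (l, psi, t))).

Lemma bsolP l psi t : ell0 psi ->
  [/\ ell0 (bsol l psi t).1, L l (bsol l psi t).1 + dl (bsol l psi t).2 = psi
    & Pi l *m ev (bsol l psi t).1 = Pi l *m t].
Proof. by rewrite /bsol; case: cid => y /= H /H. Qed.

Lemma bsolE l psi t phi w : ell0 phi -> L l phi + dl w = psi ->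
  Pi l *m ev phi = Pi l *m t -> bsol l psi t = (phi, w).
Proof.
move=> p E1 E2.
have psi0 : ell0 psi by rewrite -E1; apply: ell0_add; [exact: bL_ell0|exact: bdl_ell0].
have [s1 s2 s3] := bsolP l t psi0.
have [] := @D_inj l (bsol l psi t).1 (bsol l psi t).2 phi w.
- exact: s1.
- exact: p.
- by rewrite s2 E1.
- by rewrite s3 E2.
by case: (bsol l psi t) => a b /= -> ->.
Qed.

Lemma bsol_lin l (a : R) psi psi' t t' : ell0 psi -> ell0 psi' ->
  bsol l (a *: psi + psi') (a *: t + t') =
  (a *: (bsol l psi t).1 + (bsol l psi' t').1, a *: (bsol l psi t).2 + (bsol l psi' t').2).
Proof.
move=> p p'; have [s1 s2 s3] := bsolP l t p; have [s1' s2' s3'] := bsolP l t' p'.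
apply: bsolE.
- exact: ell0_lin.
- by rewrite (bL_lin HB) (bdl_lin HB) addrACA -scalerDr s2 s2'.
- by rewrite (bev_lin HB) !mulmxDr -!scalemxAr s3 s3'.
Qed.

Lemma cvg_bsol (I : Type) (F : set_system I) (FF : Filter F) (l : I -> T) l1
    (psi : I -> int -> 'cV[R]_d) psi1 (t : I -> 'cV[R]_e) (t1 : 'cV[R]_e) :
  l i @[i --> F] --> l1 -> ell0 psi1 -> (\forall i \near F, ell0 (psi i)) ->
  ucvg F psi psi1 -> t i @[i --> F] --> t1 ->
  ucvg F (fun i => (bsol (l i) (psi i) (t i)).1) (bsol l1 psi1 t1).1 /\
  (bsol (l i) (psi i) (t i)).2 @[i --> F] --> (bsol l1 psi1 t1).2.
Proof.
move=> ll1 p1 p0 pc tc.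
have [s1 s2 s3] := bsolP l1 t1 p1.
apply: (cvg_D_inv ll1) => //.
- by apply: filterS p0 => i /(bsolP (l i) (t i))[].
- rewrite s2; apply: ucvg_near pc.
  by apply: filterS p0 => i /(bsolP (l i) (t i))[].
- rewrite s3; apply: (@cvg_trans _ (Pi (l i) *m t i @[i --> F])).
    apply: near_eq_cvg; apply: filterS p0 => i /(bsolP (l i) (t i))[_ _ ->] //.
  by apply: cvg_mulmx; [exact: cvg_Pi|exact: tc].
Qed.

End Family.

(** * Reduction to finite matrices and the Fredholm property *)

Section Solutions.
Variables (R : realType) (d e : nat) (T : pseudoMetricType R).
Variables (L : T -> (int -> 'cV[R]_d) -> (int -> 'cV[R]_d)).
Variables (dl : 'cV[R]_d -> int -> 'cV[R]_d).
Variables (Pi : T -> 'M[R]_e) (ev : (int -> 'cV[R]_d) -> 'cV[R]_e).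
Hypothesis HB : bordered L dl Pi ev.

Section Span.
Variables (k : nat) (s : 'I_k -> int -> 'cV[R]_d).
Hypothesis s0 : forall j, ell0 (s j).

Definition lincomb (c : 'cV[R]_k) : int -> 'cV[R]_d := \sum_j c j 0 *: s j.

Lemma lincomb_ell0 c : ell0 (lincomb c).
Proof. by apply: ell0_sum => j; exact: ell0_scale. Qed.

Lemma lincomb_lin (a : R) c c' : lincomb (a *: c + c') = a *: lincomb c + lincomb c'.
Proof.
rewrite /lincomb scaler_sumr -big_split; apply: eq_bigr => j _.
by rewrite !mxE scalerDl scalerA.
Qed.

Lemma lincomb_span c : span_of s (lincomb c).
Proof. by exists (fun j => c j 0). Qed.

Lemma span_lincomb v : span_of s v -> exists c, v = lincomb c.
Proof.
by move=> [c ->]; exists (\col_j c j); apply: eq_bigr => j _; rewrite mxE.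
Qed.

(** The upper part of [u] holds coefficients of a right-hand side in the span, the lower part the
    end values. *)
Definition solu (l : T) (u : 'cV[R]_(k + e)) := bsol HB l (lincomb (usubmx u)) (dsubmx u).

Lemma soluP l u : [/\ ell0 (solu l u).1,
  L l (solu l u).1 + dl (solu l u).2 = lincomb (usubmx u)
  & Pi l *m ev (solu l u).1 = Pi l *m dsubmx u].
Proof. by rewrite /solu; apply: bsolP; exact: lincomb_ell0. Qed.

Lemma solu_lin l (a : R) u u' : solu l (a *: u + u') =
  (a *: (solu l u).1 + (solu l u').1, a *: (solu l u).2 + (solu l u').2).
Proof.
rewrite /solu !linearP /= lincomb_lin.
by apply: bsol_lin; exact: lincomb_ell0.
Qed.

Lemma solu0 l : solu l 0 = (0, 0).
Proof.
have := solu_lin l (-1) 0 0; rewrite !scaleN1r oppr0 addr0 => ->.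
by rewrite !addNr.
Qed.

Lemma solu_sum l (J : Type) (r : seq J) (c : J -> R) (u : J -> 'cV[R]_(k + e)) :
  solu l (\sum_(j <- r) c j *: u j) =
  (\sum_(j <- r) c j *: (solu l (u j)).1, \sum_(j <- r) c j *: (solu l (u j)).2).
Proof.
elim: r => [|j r IH]; first by rewrite !big_nil solu0.
by rewrite !big_cons solu_lin IH.
Qed.

(** The matrix of the map from data to jump. Data with zero defect are those for which [L l] itself,
    without a jump, is solved. *)
Definition defect (l : T) : 'M[R]_(d, k + e) :=
  \matrix_(i, j) (solu l (delta_mx j 0)).2 i 0.

Lemma defectE l u : (solu l u).2 = defect l *m u.
Proof.
have {1}-> : u = \sum_j u j 0 *: delta_mx j 0.
  by rewrite {1}[u]matrix_sum_delta; apply: eq_bigr => j _; rewrite big_ord1.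
rewrite solu_sum /=; apply/colP => i; rewrite summxE !mxE.
by apply: eq_bigr => j _; rewrite !mxE mulrC.
Qed.

Lemma cvg_solu (I : Type) (F : set_system I) (FF : Filter F) (l : I -> T) l1
    (u : I -> 'cV[R]_(k + e)) (u1 : 'cV[R]_(k + e)) :
  l i @[i --> F] --> l1 -> u i @[i --> F] --> u1 ->
  ucvg F (fun i => (solu (l i) (u i)).1) (solu l1 u1).1 /\
  (solu (l i) (u i)).2 @[i --> F] --> (solu l1 u1).2.
Proof.
move=> ll uu; apply: cvg_bsol => //.
- exact: lincomb_ell0.
- by apply: nearW => i; exact: lincomb_ell0.
- by apply: ucvg_comb => //; exact: cvg_usubmx.
- exact: cvg_dsubmx.
Qed.

Lemma cvg_defect (I : Type) (F : set_system I) (FF : Filter F) (l : I -> T) l1 :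
  l i @[i --> F] --> l1 -> defect (l i) @[i --> F] --> defect l1.
Proof.
move=> ll; apply/cvg_mxP => i j; rewrite mxE; under eq_fun do rewrite mxE.
by have [_ /cvg_mxP] := cvg_solu FF ll (cvg_cst (delta_mx j 0 : 'cV[R]_(k + e))); exact.
Qed.

End Span.

(** Changing the end values by [t] changes the jump by [M t]. So [psi] is in the range as soon as
    its jump lies in the column space of [M], and this is the linear condition [w^T K = 0], which
    survives limits. *)
Lemma bordered_closed_range l (u : nat -> int -> 'cV[R]_d) (psi : int -> 'cV[R]_d) :
  (forall j, exists2 phi, ell0 phi & u j = L l phi) -> ell0 psi ->
  (forall eps : R, 0 < eps -> exists J : nat, forall j, (J <= j)%N -> supnorm (u j - psi) < eps) ->
  exists2 phi, ell0 phi & psi = L l phi.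
Proof.
move=> uL psi0 uc.
(* For the empty family the data consist of end values only. *)
pose s (j : 'I_0) : int -> 'cV[R]_d := 0.
have s0 j : ell0 (s j) by exact: ell0_0.
have lc0 c : lincomb s c = 0 by rewrite /lincomb big_ord0.
pose M := defect s l; pose K := cokermx M^T.
have solE0 (chi : int -> 'cV[R]_d) (t : 'cV[R]_(0 + e)) : ell0 chi ->
    (bsol HB l chi (dsubmx t)).2 = (bsol HB l chi 0).2 + M *m t.
  move=> chi0; rewrite /M -(defectE s0) /solu lc0.
  have := bsol_lin HB l 1 0 (dsubmx t) chi0 (@ell0_0 R d).
  by rewrite !scale1r addr0 add0r => ->.
have psi_oo : ucvg \oo u psi.
  apply/(ucvg_supnorm psi0).
    by apply: nearW => j; have [phi p ->] := uL j; exact: (bL_ell0 HB).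
  apply/cvgr0Pnorm_le => eps /uc[J HJ]; near=> j.
  have uj : ell0 (u j - psi).
    by apply: ell0_sub => //; have [phi p ->] := uL j; exact: (bL_ell0 HB).
  rewrite ger0_norm; last exact: le_trans (normr_ge0 _) (supnorm_ge 0 uj).
  by apply/ltW/HJ; near: j; exists J.
have [_ Wc] := @cvg_bsol _ _ _ _ _ _ _ _ HB nat \oo _ (fun _ => l) l u psi
  (fun _ => 0) 0 (cvg_cst l) psi0
  (nearW _ (fun j => let: ex_intro2 phi p E := uL j in
     eq_ind_r (fun v => ell0 v) (bL_ell0 HB l p) E)) psi_oo (cvg_cst _).
have Wc0 : (bsol HB l (u j) 0).2^T *m K @[j --> \oo] --> (bsol HB l psi 0).2^T *m K.
  by apply: cvg_mulmx; [exact: cvg_trmx|exact: cvg_cst].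
have W0 : (bsol HB l psi 0).2^T *m K = 0.
  apply: (cvg_unique (@norm_hausdorff _ _) Wc0).
  rewrite (_ : (fun j => _) = (fun _ : nat => 0)); first exact: cvg_cst.
  apply/funext => j; have [phi p ujE] := uL j.
  have uj : ell0 (u j) by rewrite ujE; exact: (bL_ell0 HB).
  have := solE0 (u j) (col_mx 0 (ev phi)) uj; rewrite col_mxKd.
  have -> : bsol HB l (u j) (ev phi) = (phi, 0).
    by apply: bsolE => //; rewrite (dl_zero HB) addr0.
  move=> /esym/eqP; rewrite addr_eq0 => /eqP->.
  by rewrite linearN /= trmx_mul mulNmx -mulmxA mulmx_coker mulmx0 oppr0.
have : ((bsol HB l psi 0).2^T <= M^T)%MS by rewrite submxE W0.
move=> /submxP[D DE].
(* These end values cancel the jump. *)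
have := solE0 psi (- D^T) psi0.
have -> : (bsol HB l psi 0).2 = M *m D^T by rewrite -[LHS]trmxK DE trmx_mul trmxK.
rewrite mulmxN subrr => w0.
have [q1 q2 _] := bsolP HB l (dsubmx (- D^T : 'cV_(0 + e))) psi0.
by exists (bsol HB l psi (dsubmx (- D^T : 'cV_(0 + e)))).1 => //; rewrite -[LHS]q2 w0 (dl_zero HB) addr0.
Unshelve. all: by end_near. Qed.

(** A kernel element is the solution whose data are its own end values, and these are annihilated by
    [M]. The rows of [kermx M^T] span all such data; linear independence of the resulting solutions
    is not asked for. *)
Lemma bordered_kernel l : finite_dim_subspace_ell0 [set phi | ell0 phi /\ L l phi = 0].
Proof.
pose s (j : 'I_0) : int -> 'cV[R]_d := 0.
have s0 j : ell0 (s j) by exact: ell0_0.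
have lc0 c : lincomb s c = 0 by rewrite /lincomb big_ord0.
pose M := defect s l; pose K := kermx M^T.
pose z i := (solu s l (row i K)^T).1.
have z0 i : ell0 (z i) by have [] := soluP s0 l (row i K)^T.
exists (0 + e)%N, z; split=> //.
apply/seteqP; split=> [phi [p Lp]|_ [c ->]] /=.
  pose u : 'cV[R]_(0 + e) := col_mx 0 (ev phi).
  have uE : solu s l u = (phi, 0).
    by apply: bsolE; rewrite ?col_mxKd// lc0 (dl_zero HB) addr0.
  have : M *m u = 0 by rewrite -(defectE s0) uE.
  move=> /(congr1 trmx); rewrite trmx_mul trmx0 => /eqP; rewrite -sub_kermx => /submxP[D DE].
  exists (fun i => D 0 i); rewrite -[LHS]/((phi, 0 : 'cV[R]_d).1) -uE.
  have -> : u = \sum_i D 0 i *: (row i K)^T.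
    rewrite -[u]trmxK DE mulmx_sum_row linear_sum /=.
    by apply: eq_bigr => i _; rewrite linearZ.
  by rewrite solu_sum.
have Lz i : L l (z i) = 0.
  have [_ + _] := soluP s0 l (row i K)^T; rewrite lc0 (defectE s0).
  have -> : M *m (row i K)^T = 0.
    by rewrite -[LHS]trmxK trmx_mul trmxK -row_mul mulmx_ker row0 trmx0.
  by rewrite (dl_zero HB) addr0.
split; first by apply: ell0_sum => i; exact: ell0_scale.
apply: (big_ind (fun x => L l x = 0)) => [|x y Hx Hy|i _].
- exact: (L_zero HB).
- by rewrite -[x]scale1r (bL_lin HB) Hx Hy scaler0 addr0.
- by rewrite -[_ *: _]addr0 (bL_lin HB) Lz (L_zero HB) scaler0 addr0.
Qed.

(** Bordered solvability says that the jumps supplement the range of [L l], with one space for all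
    parameters. *)
Lemma bordered_admissible : exists V, admissible L V.
Proof.
exists (span_of (fun i : 'I_d => dl (delta_mx i 0))); split.
  by exists d, (fun i => dl (delta_mx i 0)); split => // i; exact: (bdl_ell0 HB).
move=> l psi psi0; have [phi [w [p E _]]] := bD_ex HB (l := l) (t := 0) psi0 (mulmx0 _ _).
exists phi, (dl w); split=> //; exists (fun i => w i 0).
have {1}-> : w = \sum_j w j 0 *: delta_mx j 0.
  by rewrite {1}[w]matrix_sum_delta; apply: eq_bigr => j _; rewrite big_ord1.
elim: (index_enum _) => [|j r IH]; first by rewrite !big_nil (dl_zero HB).
by rewrite !big_cons (bdl_lin HB) IH.
Qed.

Lemma bordered_fredholm : cont_fredholm_family L.
Proof.
have S0 phi : ell0 phi -> 0 <= supnorm phi.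
  by move=> p; exact: le_trans (normr_ge0 _) (supnorm_ge 0 p).
split=> [l|l1 eps eps0]; last first.
  have [eta eta0 H] := bL_cont HB l1 eps0; exists eta => // l phi ll p.
  by apply: supnorm_le => n; apply: H => // m; exact: supnorm_ge.
split; [|split; [exact: bordered_kernel|split; [exact: bordered_closed_range|]]].
  split; [exact: (bL_ell0 HB)|split; first by move=> a x y _ _; exact: (bL_lin HB)].
  have [C C0 H] := bL_bound HB l; exists C => phi p.
  by apply: supnorm_le => n; apply: H => // m; exact: supnorm_ge.
have [V [V1 V2]] := bordered_admissible.
by exists V; split => //; exact: V2.
Qed.

End Solutions.

(** * Bundles *)

Section Bundles.
Variables (R : realType) (T : pseudoMetricType R).

(** The epsilon-delta clauses of [vbundle] and [bundle_iso] become convergence along one filter on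
    pairs, so that limits can be composed without tracking radii. The filter is not claimed to be
    proper. *)
Lemma eps_delta (X : Type) (D : T -> X -> Prop) (l1 : T) (a b : T -> X -> R) :
  (forall F : set_system (T * X), Filter F -> p.1 @[p --> F] --> l1 ->
     (\forall p \near F, D p.1 p.2) ->
     (forall eps, 0 < eps -> \forall p \near F, a p.1 p.2 < eps) ->
     forall eps, 0 < eps -> \forall p \near F, b p.1 p.2 < eps) ->
  forall eps : R, 0 < eps -> exists2 eta : R, 0 < eta &
    forall l x, D l x -> ball l1 eta l -> a l x < eta -> b l x < eps.
Proof.
move=> H eps eps0.
pose F : set_system (T * X) := [set A | exists2 eta : R, 0 < eta &
  forall l x, D l x -> ball l1 eta l -> a l x < eta -> A (l, x)].
have FF : Filter F.
  split.
  - by exists 1.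
  - move=> A B [eta1 h1 H1] [eta2 h2 H2]; exists (Num.min eta1 eta2).
      by rewrite lt_min h1.
    move=> l x Dl ll; rewrite lt_min => /andP[a1 a2]; split.
      by apply: H1 => //; apply: le_ball ll; rewrite ge_min lexx.
    by apply: H2 => //; apply: le_ball ll; rewrite ge_min lexx orbT.
  - by move=> A B AB [eta h1 H1]; exists eta => // l x Dl ll al; apply/AB/H1.
have [||e e0|eta eta0 He] := H F FF _ _ _ eps eps0.
- move=> A; rewrite -nbhs_ballE => -[e /= e0 He]; exists e => // l x _ ll _.
  exact: He.
- by exists 1.
- by exists e.
by exists eta => // l x Dl ll al; exact: (He l x).
Qed.

Lemma vbundle_iso (X Y : lmodType R) (nX : X -> R) (nY : Y -> R)
    (E : T -> set X) (F : T -> set Y) :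
  vbundle nX E -> bundle_iso nX nY E F -> vbundle nY F.
Proof.
move=> vE [f [fl [fc fi]]] l0.
have [dl [dl0 [k [phi [ph [phc phi_inv]]]]]] := vE l0.
have phE l v : ball l0 dl l -> E l (phi l v).
  by move=> /ph[_ [_ <-]]; exists v.
exists dl; split => //; exists k, (fun l v => f l (phi l v)); split; [|split].
- move=> l ll; have [plin [pinj pim]] := ph l ll; have [flin [finj fim]] := fl l.
  split; first by move=> a u v; rewrite plin flin//; exact: phE.
  split; first by move=> u v /finj uv; apply/pinj/uv; exact: phE.
  apply/seteqP; split=> [_ [v _ <-]|y].
    by rewrite -fim; exists (phi l v) => //; exact: phE.
  rewrite -fim => -[x]; rewrite -pim => -[v _ <-] <-.
  by exists v.
- move=> l1 v1 ll1 e e0.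
  have [eta1 h1 H1] := fc l1 (phi l1 v1) (phE _ _ ll1) e e0.
  have [eta2 h2 H2] := phc l1 v1 ll1 eta1 h1.
  exists (Num.min eta1 eta2); first by rewrite lt_min h1.
  move=> l v ll ll' vv; apply: H1.
  + exact: phE.
  + by apply: le_ball ll'; rewrite ge_min lexx.
  + apply: H2 => //; first by apply: le_ball ll'; rewrite ge_min lexx orbT.
    by apply: lt_le_trans vv _; rewrite ge_min lexx orbT.
- move=> l1 v1 ll1 e e0.
  have [eta1 h1 H1] := phi_inv l1 v1 ll1 e e0.
  have [eta2 h2 H2] := fi l1 (phi l1 v1) (phE _ _ ll1) eta1 h1.
  exists (Num.min eta1 eta2); first by rewrite lt_min h1.
  move=> l v ll ll' vv; apply: (H1 l) => //.
    by apply: le_ball ll'; rewrite ge_min lexx.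
  apply: H2; first exact: phE.
    by apply: le_ball ll'; rewrite ge_min lexx orbT.
  by apply: lt_le_trans vv _; rewrite ge_min lexx orbT.
Qed.

Lemma cvg_lt_normP (I : Type) (F : set_system I) (FF : Filter F) m n
    (f : I -> 'M[R]_(m, n)) (a : 'M[R]_(m, n)) :
  f i @[i --> F] --> a <-> forall eps : R, 0 < eps -> \forall i \near F, `|f i - a| < eps.
Proof. by split=> /cvgrPdistC_lt. Qed.

Definition proj_im n (P : T -> 'M[R]_n) : T -> set 'cV[R]_n :=
  fun l => [set x | exists y, x = P l *m y].

(* [W l = P(l) P(l0) + (1 - P(l)) (1 - P(l0))] is close to the identity and
   intertwines [P(l0)] with [P(l)]. *)
Lemma proj_vbundle n (P : T -> 'M[R]_n) :
  (forall l, P l *m P l = P l) -> continuous P -> vbundle (@cvnorm R n) (proj_im P).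
Proof.
move=> PP Pc l0.
pose W l := P l *m P l0 + (1%:M - P l) *m (1%:M - P l0).
have WP l : W l *m P l0 = P l *m W l.
  have QP : (1%:M - P l0) *m P l0 = 0 by rewrite mulmxBl mul1mx PP subrr.
  have PQ : P l *m (1%:M - P l) = 0 by rewrite mulmxBr mulmx1 PP subrr.
  rewrite /W [LHS]mulmxDl [RHS]mulmxDr -(mulmxA (P l)) PP -(mulmxA (1%:M - P l)) QP mulmx0.
  by rewrite !mulmxA PP PQ mul0mx.
have Wc l1 : W l @[l --> l1] --> W l1.
  apply: cvgD; first by apply: cvg_mulmx; [exact: Pc|exact: cvg_cst].
  apply: cvg_mulmx; last exact: cvg_cst.
  by apply: cvgB; [exact: cvg_cst|exact: Pc].
have W0 : W l0 = 1%:M.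
  rewrite /W PP [X in _ + X]mulmxBl mul1mx [X in _ + (_ - X)]mulmxBr mulmx1 PP subrr subr0.
  by rewrite addrC subrK.
have : \forall l \near l0, W l \in unitmx.
  by apply: near_unitmx (Wc l0) _; rewrite W0 unitmx1.
move=> /nbhs_ballP[dl /= dl0 HW].
pose k := \rank (P l0)^T; pose B : 'M[R]_(n, k) := (row_base (P l0)^T)^T.
have [C CB] : exists C : 'M[R]_(k, n), C *m B = 1%:M.
  have /row_freeP[X HX] := row_base_free (P l0)^T.
  by exists X^T; rewrite -trmx_mul HX trmx1.
have [D1 BD] : exists D1, B = P l0 *m D1.
  have /submxP[D DE] : (row_base (P l0)^T <= (P l0)^T)%MS by rewrite eq_row_base.
  by exists D^T; rewrite /B DE trmx_mul trmxK.
have [D2 PD] : exists D2, P l0 = B *m D2.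
  have /submxP[D DE] : ((P l0)^T <= row_base (P l0)^T)%MS by rewrite eq_row_base.
  by exists D^T; rewrite /B -trmx_mul -DE trmxK.
have inv l (v : 'cV[R]_k) : ball l0 dl l -> v = C *m (invmx (W l) *m (W l *m (B *m v))).
  by move=> /HW Wu; rewrite mulKmx// mulmxA CB mul1mx.
exists dl; split => //; exists k, (fun l v => W l *m (B *m v)); split; [|split].
- move=> l ll; split; first by move=> a u v; rewrite !mulmxDr -!scalemxAr.
  split; first by move=> u v uv; rewrite (inv l u ll) (inv l v ll) uv.
  apply/seteqP; split=> [_ [v _ <-]|_ [y ->]].
    by exists (W l *m (D1 *m v)); rewrite !mulmxA -WP -!mulmxA (mulmxA (P l0)) -BD.
  exists (D2 *m (invmx (W l) *m y)) => //.
  by rewrite (mulmxA B) -PD (mulmxA (W l)) WP -mulmxA mulKVmx// HW.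
- move=> l1 v1 ll1 eps eps0.
  apply: (@eps_delta _ (fun l _ => ball l0 dl l) l1 (fun l v => `|v - v1|)
    (fun l v => cvnorm (W l *m (B *m v) - W l1 *m (B *m v1)))) => // F FF Fl _.
  move=> /cvg_lt_normP vc; apply/(@cvg_lt_normP _ F FF n 1 (fun p => W p.1 *m (B *m p.2))).
  apply: cvg_mulmx; first exact: (cvg_comp _ _ Fl (Wc l1)).
  by apply: cvg_mulmx; [exact: cvg_cst|exact: vc].
- move=> l1 v1 ll1 eps eps0.
  apply: (@eps_delta _ (fun l _ => ball l0 dl l) l1
    (fun l v => cvnorm (W l *m (B *m v) - W l1 *m (B *m v1))) (fun l v => `|v - v1|))
    => // F FF Fl Fd.
  move=> /(@cvg_lt_normP _ F FF n 1 (fun p => W p.1 *m (B *m p.2))) vc.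
  apply/cvg_lt_normP; rewrite (inv l1 v1 ll1).
  apply: (@cvg_trans _ (C *m (invmx (W p.1) *m (W p.1 *m (B *m p.2))) @[p --> F])).
    apply: near_eq_cvg; apply: filterS Fd => p /inv H.
    exact/esym/H.
  apply: cvg_mulmx; first exact: cvg_cst.
  apply: cvg_mulmx; last exact: vc.
  apply: cvg_invmx; last exact: HW.
  exact: (cvg_comp _ _ Fl (Wc l1)).
Qed.

End Bundles.

(** * Free spanning families and their coefficients *)

Section FiniteDim.
Variables (R : realType) (d : nat).
Implicit Types (V : set (int -> 'cV[R]_d)).

Lemma span_dependent k (s : 'I_k.+1 -> int -> 'cV[R]_d) (c : 'cV[R]_k.+1) j :
  lincomb s c = 0 -> c j 0 != 0 -> span_of s = span_of (fun i => s (lift j i)).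
Proof.
move=> c0 cj; apply/seteqP; split=> x [a ->].
  (* Subtracting [a j / c j 0] times the relation removes the coefficient of [s j]. *)
  exists (fun i => a (lift j i) - a j / c j 0 * c (lift j i) 0).
  have -> : \sum_i a i *: s i = \sum_i (a i - a j / c j 0 * c i 0) *: s i.
    under [RHS]eq_bigr do rewrite scalerBl -scalerA.
    by rewrite sumrB -scaler_sumr -/(lincomb s c) c0 scaler0 subr0.
  by rewrite (bigD1_ord j)//= divfK// subrr scale0r add0r.
exists (fun i => if unlift j i is Some i' then a i' else 0).
rewrite [RHS](bigD1_ord j)//= unlift_none scale0r add0r.
by apply: eq_bigr => i _; rewrite liftK.
Qed.

(** A spanning family of least length is free, since a nontrivial relation would allow one member to
    be dropped. *)
Lemma free_spanning V : finite_dim_subspace_ell0 V ->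
  exists k (s : 'I_k -> int -> 'cV[R]_d), [/\ forall i, ell0 (s i), V = span_of s
    & forall c, lincomb s c = 0 -> c = 0].
Proof.
move=> Vf.
have exk : exists k, `[< exists s : 'I_k -> int -> 'cV[R]_d,
    (forall i, ell0 (s i)) /\ V = span_of s >].
  by have [k Hk] := Vf; exists k; apply/asboolP.
case: (ex_minnP exk) => k /asboolP[s [s0 Vs]] kmin; exists k, s; split=> // c c0.
apply/colP => j; rewrite mxE; apply/eqP; apply: contraT => cj.
case: k s s0 Vs kmin c c0 j cj => [|k] s s0 Vs kmin c c0 j cj; first by case: j cj.
suff /kmin : `[< exists s : 'I_k -> int -> 'cV[R]_d,
    (forall i, ell0 (s i)) /\ V = span_of s >] by rewrite ltnn.
apply/asboolP; exists (fun i => s (lift j i)); split=> //.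
by rewrite Vs; exact: span_dependent c0 cj.
Qed.

(* A free family of vector-valued sequences is separated by finitely many
   coordinate evaluations, so its coefficients are bounded in the sup norm. *)
Lemma free_coef k (s : 'I_k -> int -> 'cV[R]_d) :
  (forall c, lincomb s c = 0 -> c = 0) ->
  exists cf : (int -> 'cV[R]_d) -> 'cV[R]_k,
  [/\ forall c, cf (lincomb s c) = c,
      forall phi psi, cf (phi - psi) = cf phi - cf psi
    & exists2 C : R, 0 <= C & forall phi b, 0 <= b ->
        (forall n, `|phi n| <= b) -> `|cf phi| <= C * b].
Proof.
move=> sfree.
(* Each column of such an [X] is one coordinate evaluated on the whole family; an [X] of maximal
   rank is chosen. *)
pose isev m (X : 'M[R]_(k, m)) := forall j, exists p : int * 'I_d,
  forall i, X i j = s i p.1 p.2 0.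
have exr : exists r, `[< exists m (X : 'M[R]_(k, m)), isev m X /\ \rank X = r >].
  by exists 0%N; apply/asboolP; exists 0%N, 0; split; [case|rewrite mxrank0].
have ler r : `[< exists m (X : 'M[R]_(k, m)), isev m X /\ \rank X = r >] -> (r <= k)%N.
  by move=> /asboolP[m [X [_ <-]]]; exact: rank_leq_row.
case: (ex_maxnP exr ler) => r /asboolP[m [X [Xev Xr]]] rmax.
have Xfree : row_free X.
  rewrite -kermx_eq0; apply/eqP/row_matrixP => i; rewrite row0.
  apply/eqP; apply: contraT => ci; set c := row i _ in ci.
  have cX : c *m X = 0 by rewrite /c -row_mul mulmx_ker row0.
  have [n [i2 Hn]] : exists n i2, lincomb s c^T n i2 0 != 0.
    apply: contrapT => H; move/eqP: ci; apply.
    have /sfree/(congr1 trmx) : lincomb s c^T = 0; last by rewrite trmxK trmx0.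
    apply/funext => n; apply/colP => i2.
    rewrite -[RHS]/((0 : 'cV[R]_d) i2 0) mxE; apply/eqP.
    by apply: contrapT => /negP Hn; apply: H; exists n, i2.
  (* Appending an evaluation that does not vanish on the combination [c] removes [c] from the left
     kernel, against maximality of the rank. *)
  pose X' := row_mx X (\col_i1 s i1 n i2 0).
  have X'ev : isev _ X'.
    move=> j; case: (split_ordP j) => j' ->.
      by have [p Hp] := Xev j'; exists p => i1; rewrite row_mxEl.
    by exists (n, i2) => i1; rewrite row_mxEr mxE.
  have rX' : (\rank X' <= \rank X)%N.
    by rewrite Xr; apply: rmax; apply/asboolP; exists (m + 1)%N, X'.
  have kX : (kermx X' <= kermx X)%MS.
    rewrite sub_kermx; have := mulmx_ker X'; rewrite mul_mx_row -row_mx0.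
    by move=> /eq_row_mx[-> _].
  have Xk : (kermx X <= kermx X')%MS.
    by rewrite -(mxrank_leqif_sup kX) eqn_leq mxrankS//= !mxrank_ker leq_sub2l.
  have : c *m X' = 0.
    apply/eqP; rewrite -sub_kermx; apply: submx_trans Xk.
    by rewrite sub_kermx cX.
  rewrite mul_mx_row -row_mx0 => /eq_row_mx[_ /matrixP/(_ 0 0)].
  rewrite !mxE => E0; move: Hn; rewrite -E0; case/eqP.
  rewrite /lincomb fct_sumE summxE; apply: eq_bigr => i1 _.
  by rewrite fctE !mxE.
have [Y XY] := row_freeP Xfree.
have [p Hp] := choice Xev.
pose rw (phi : int -> 'cV[R]_d) : 'rV[R]_m := \row_j phi (p j).1 (p j).2 0.
exists (fun phi => (rw phi *m Y)^T); split.
- move=> c; have -> : rw (lincomb s c) = c^T *m X.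
    apply/rowP => j; rewrite !mxE /lincomb fct_sumE summxE; apply: eq_bigr => i _.
    by rewrite fctE !mxE Hp.
  by rewrite -mulmxA XY mulmx1 trmxK.
- move=> phi psi; rewrite -linearB -mulmxBl; congr (_ *m _)^T.
  by apply/rowP => j; rewrite !mxE.
- exists (m%:R * `|Y|) => [|phi b b0 Hb]; first by rewrite mulr_ge0.
  have rwb : `|rw phi| <= b.
    apply: mx_norm_le => // i j; rewrite mxE (le_trans _ (Hb (p j).1))//.
    exact: mx_coord_le.
  apply: mx_norm_le => [|i j]; first by rewrite !mulr_ge0.
  rewrite mxE (le_trans (mx_coord_le _ _ _))// (le_trans (mulmx_norm_le _ _))//.
  by rewrite mulrAC ler_wpM2l// mulr_ge0.
Qed.

End FiniteDim.

(** * The index bundle *)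

Section IndexBundle.
Variables (R : realType) (d e : nat) (T : pseudoMetricType R).
Variables (L : T -> (int -> 'cV[R]_d) -> (int -> 'cV[R]_d)).
Variables (dl : 'cV[R]_d -> int -> 'cV[R]_d).
Variables (Pi : T -> 'M[R]_e) (ev : (int -> 'cV[R]_d) -> 'cV[R]_e).
Hypothesis HB : bordered L dl Pi ev.
Variables (k : nat) (s : 'I_k -> int -> 'cV[R]_d).
Hypothesis s0 : forall j, ell0 (s j).
Hypothesis Vadm : admissible L (span_of s).

Lemma span_of_lin (a : R) v v' : span_of s v -> span_of s v' -> span_of s (a *: v + v').
Proof.
move=> /span_lincomb[c ->] /span_lincomb[c' ->]; rewrite -lincomb_lin.
exact: lincomb_span.
Qed.

Lemma span_of_add v v' : span_of s v -> span_of s v' -> span_of s (v + v').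
Proof. by move=> vs vs'; rewrite -[v]scale1r; exact: span_of_lin. Qed.

Lemma span_of_sub v v' : span_of s v -> span_of s v' -> span_of s (v - v').
Proof. by move=> vs vs'; rewrite addrC -scaleN1r; exact: span_of_lin. Qed.

Lemma span_of_ell0 v : span_of s v -> ell0 v.
Proof. by move=> /span_lincomb[c ->]; exact: lincomb_ell0. Qed.

Local Notation M := (defect HB s).
Local Notation N l := (rinv (M l)).

(** Admissibility writes [dl w = L phi + v]; then [(- phi, w)] solves the bordered equation with
    right-hand side [v] in the span. *)
Lemma defect_surj l (w : 'cV[R]_d) : exists u, M l *m u = w.
Proof.
have [phi [v [p /span_lincomb[c cE] E]]] := Vadm.2 l _ (bdl_ell0 HB w).
exists (col_mx c (ev (- phi))); rewrite -defectE// /solu col_mxKu col_mxKd.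
rewrite (@bsolE _ _ _ _ _ _ _ _ HB _ _ _ (- phi) w)//; first exact: ell0_opp.
by rewrite E -sub0r (LB HB) (L_zero HB) cE sub0r addKr.
Qed.

Lemma defectK l (w : 'cV[R]_d) : M l *m (N l *m w) = w.
Proof. by rewrite mulmxA mulmx_rinv ?mul1mx//; exact: defect_surj. Qed.

(** A splitting of the projection onto the jump: among the solutions with right-hand side in the
    span, one with jump [w], linear in [w] and continuous in all variables. *)
Definition rho l (w : 'cV[R]_d) : int -> 'cV[R]_d := (solu HB s l (N l *m w)).1.

Lemma rho_ell0 l w : ell0 (rho l w).
Proof. by have [] := soluP HB s0 l (N l *m w). Qed.

Lemma rho_lin l (a : R) w w' : rho l (a *: w + w') = a *: rho l w + rho l w'.
Proof. by rewrite /rho mulmxDr -scalemxAr solu_lin. Qed.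

Lemma rho_span l w : span_of s (L l (rho l w) + dl w).
Proof.
have [_ + _] := soluP HB s0 l (N l *m w).
by rewrite defectE// defectK => ->; exact: lincomb_span.
Qed.

Lemma cvg_N (I : Type) (F : set_system I) (FF : Filter F) (l : I -> T) l1 :
  l i @[i --> F] --> l1 -> N (l i) @[i --> F] --> N l1.
Proof.
move=> ll; apply: cvg_rinv; first exact: defect_surj.
exact: cvg_defect.
Qed.

Lemma cvg_rho (I : Type) (F : set_system I) (FF : Filter F) (l : I -> T) l1
    (w : I -> 'cV[R]_d) (w1 : 'cV[R]_d) :
  l i @[i --> F] --> l1 -> w i @[i --> F] --> w1 ->
  ucvg F (fun i => rho (l i) (w i)) (rho l1 w1).
Proof.
move=> ll ww; have [] // := @cvg_solu _ _ _ _ _ _ _ _ HB _ s s0 _ F FF l l1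
  (fun i => N (l i) *m w i) (N l1 *m w1) ll.
by apply: cvg_mulmx; [exact: cvg_N|exact: ww].
Qed.

Definition diagPi l : 'M[R]_(k + e) := block_mx 1%:M 0 0 (Pi l).

Lemma diagPiE l (u : 'cV[R]_(k + e)) :
  diagPi l *m u = col_mx (usubmx u) (Pi l *m dsubmx u).
Proof.
by rewrite -{1}[u]vsubmxK mul_block_col !mul0mx mul1mx addr0 add0r.
Qed.

Lemma diagPi_proj l : diagPi l *m diagPi l = diagPi l.
Proof.
by apply: matrix_mulP => u; rewrite -mulmxA !diagPiE col_mxKu col_mxKd mulmxA (bPi_proj HB).
Qed.

Lemma solu_diagPi l u : solu HB s l (diagPi l *m u) = solu HB s l u.
Proof.
have [p1 p2 p3] := soluP HB s0 l u.
rewrite /solu diagPiE col_mxKu col_mxKd.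
rewrite (@bsolE _ _ _ _ _ _ _ _ HB _ _ _ (solu HB s l u).1 (solu HB s l u).2)//.
  by rewrite -surjective_pairing.
by rewrite p3 mulmxA (bPi_proj HB).
Qed.

Lemma defect_diagPi l : M l *m diagPi l = M l.
Proof. by apply: matrix_mulP => u; rewrite -mulmxA -!defectE// solu_diagPi. Qed.

(** The usual [1 - N M], compressed by [diagPi]. Since [M] absorbs [diagPi], this is a projector
    onto the data that are fixed by [diagPi] and have no defect. *)
Definition kerproj l : 'M[R]_(k + e) := diagPi l - diagPi l *m N l *m M l.

Lemma diagPi_kerproj l : diagPi l *m kerproj l = kerproj l.
Proof. by rewrite /kerproj mulmxBr !mulmxA diagPi_proj. Qed.

Lemma defect_kerproj l : M l *m kerproj l = 0.
Proof.
rewrite /kerproj mulmxBr (mulmxA (M l)) (mulmxA (M l) (diagPi l)) defect_diagPi.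
rewrite mulmx_rinv ?mul1mx ?subrr//.
exact: defect_surj.
Qed.

Lemma kerprojP l (u : 'cV[R]_(k + e)) : (kerproj l *m u = u) <-> (diagPi l *m u = u /\ M l *m u = 0).
Proof.
split=> [E|[E1 E2]]; last by rewrite /kerproj mulmxBl E1 -[_ *m M l *m u]mulmxA E2 mulmx0 subr0.
split; rewrite -E mulmxA; first by rewrite diagPi_kerproj.
by rewrite defect_kerproj mul0mx.
Qed.

Lemma kerproj_proj l : kerproj l *m kerproj l = kerproj l.
Proof.
apply: matrix_mulP => u; rewrite -mulmxA; apply/kerprojP.
by rewrite !mulmxA diagPi_kerproj defect_kerproj mul0mx.
Qed.

Lemma kerproj_cont : continuous kerproj.
Proof.
move=> l; have idl : (fun x => x) x @[x --> l] --> l by exact: cvg_id.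
have cP : diagPi x @[x --> l] --> diagPi l.
  by apply: cvg_block_diag; [exact: cvg_cst|exact: (@bPi_cont _ _ _ _ _ _ _ _ HB l)].
apply: cvgB; first exact: cP.
apply: cvg_mulmx; last exact: cvg_defect.
by apply: cvg_mulmx; [exact: cP|exact: cvg_N].
Qed.

Lemma ucvg_ltP (I : Type) (F : set_system I) (FF : Filter F)
    (g : I -> int -> 'cV[R]_d) gl : ell0 gl -> (\forall i \near F, ell0 (g i)) ->
  (ucvg F g gl <-> forall eps, 0 < eps -> \forall i \near F, supnorm (g i - gl) < eps).
Proof.
move=> gl0 g0; split=> [/(ucvg_supnorm gl0 g0)/cvgr0Pnorm_lt H eps /H|H].
  by apply: filterS => i; apply: le_lt_trans; exact: ler_norm.
apply/(ucvg_supnorm gl0 g0)/cvgr0Pnorm_lt => eps /H; apply: filterS2 g0 => i gi.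
by rewrite ger0_norm//; exact: le_trans (normr_ge0 _) (supnorm_ge 0 (ell0_sub gi gl0)).
Qed.

Hypothesis sfree : forall c, lincomb s c = 0 -> c = 0.

(** A finite-dimensional model of [E(V)]. The data are recovered from [phi] as the coefficients of
    [L phi] and the projected end values; the bound on [cf] makes this recovery continuous. *)
Lemma EL_iso :
  bundle_iso (@cvnorm R (k + e)) (@supnorm R d) (proj_im kerproj) (EL L (span_of s)).
Proof.
have [cf [cfK cfB [C C0 cfC]]] := free_coef sfree.
have imP l u : proj_im kerproj l u -> diagPi l *m u = u /\ M l *m u = 0.
  by move=> [y ->]; apply/kerprojP; rewrite mulmxA kerproj_proj.
have LE l u : proj_im kerproj l u -> L l (solu HB s l u).1 = lincomb s (usubmx u).
  move=> /imP[_ E2]; have [_ <- _] := soluP HB s0 l u.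
  by rewrite defectE// E2 (dl_zero HB) addr0.
have uE l u : proj_im kerproj l u ->
    u = col_mx (cf (L l (solu HB s l u).1)) (Pi l *m ev (solu HB s l u).1).
  move=> iu; rewrite LE// cfK; have [_ _ ->] := soluP HB s0 l u.
  by have [E1 _] := imP _ _ iu; rewrite -diagPiE E1.
exists (fun l u => (solu HB s l u).1); split; [|split].
- move=> l; split; first by move=> a x y _ _; rewrite solu_lin.
  split; first by move=> x y ix iy E; rewrite (uE l x ix) (uE l y iy) E.
  apply/seteqP; split=> [_ [u iu <-]|phi [p vs]].
    split; first by have [] := soluP HB s0 l u.
    by rewrite LE//; exact: lincomb_span.
  have [c cE] := span_lincomb vs.
  pose u := col_mx c (Pi l *m ev phi).
  have su : solu HB s l u = (phi, 0).
    rewrite /solu col_mxKu col_mxKd; apply: bsolE => //.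
      by rewrite (dl_zero HB) addr0.
    by rewrite mulmxA (bPi_proj HB).
  exists u; last by rewrite su.
  exists u; apply/esym/kerprojP; split.
    by rewrite diagPiE col_mxKu col_mxKd mulmxA (bPi_proj HB).
  by rewrite -defectE// su.
- move=> l1 x1 E1.
  apply: (@eps_delta _ _ _ (fun l x => proj_im kerproj l x) l1 (fun l x => cvnorm (x - x1))
    (fun l x => supnorm ((solu HB s l x).1 - (solu HB s l1 x1).1))) => F FF Fl Fd.
  move=> /(@cvg_lt_normP _ _ F FF _ _ (fun p => p.2)) xc.
  apply/(@ucvg_ltP _ F FF (fun p => (solu HB s p.1 p.2).1)).
  + by have [] := soluP HB s0 l1 x1.
  + by apply: nearW => p; have [] := soluP HB s0 p.1 p.2.
  + by have [] := cvg_solu HB s0 FF Fl xc.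
- move=> l1 x1 E1.
  apply: (@eps_delta _ _ _ (fun l x => proj_im kerproj l x) l1
    (fun l x => supnorm ((solu HB s l x).1 - (solu HB s l1 x1).1))
    (fun l x => cvnorm (x - x1))) => F FF Fl Fd.
  have p1 : ell0 (solu HB s l1 x1).1 by have [] := soluP HB s0 l1 x1.
  have pF : \forall p \near F, ell0 (solu HB s p.1 p.2).1.
    by apply: nearW => p; have [] := soluP HB s0 p.1 p.2.
  move=> /(@ucvg_ltP _ F FF (fun p => (solu HB s p.1 p.2).1) _ p1 pF) pc.
  apply/(@cvg_lt_normP _ _ F FF _ _ (fun p => p.2)).
  rewrite (uE l1 x1 E1).
  apply: (@cvg_trans _ (col_mx (cf (L p.1 (solu HB s p.1 p.2).1))
     (Pi p.1 *m ev (solu HB s p.1 p.2).1) @[p --> F])).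
    by apply: near_eq_cvg; apply: filterS Fd => p ip; rewrite -uE.
  apply: cvg_col_mx; last first.
    by apply: cvg_mulmx; [exact: (cvg_Pi HB Fl)|exact: (cvg_ev HB pc)].
  have Lc := cvg_L HB Fl p1 pc.
  apply/cvgrPdistC_le => eps eps0.
  have C1 : 0 < C + 1 by rewrite ltr_wpDl.
  have := Lc FF _ (divr_gt0 eps0 C1); apply: filterS => p Hp.
  rewrite -cfB; apply: le_trans (cfC _ (eps / (C + 1)) _ Hp) _.
    by rewrite ltW// divr_gt0.
  by rewrite mulrCA ler_piMr ?(ltW eps0)// ler_pdivrMr// mul1r lerDl.
Qed.

Lemma EL_vbundle : vbundle (@supnorm R d) (EL L (span_of s)).
Proof.
apply: vbundle_iso EL_iso; apply: proj_vbundle; [exact: kerproj_proj|exact: kerproj_cont].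
Qed.

End IndexBundle.

(** * The stable isomorphism of bundles *)

Section KOIso.
Variables (R : realType) (d : nat) (T : pseudoMetricType R).
Variables (L : T -> (int -> 'cV[R]_d) -> (int -> 'cV[R]_d)).
Variables (dl : 'cV[R]_d -> int -> 'cV[R]_d).
Variables (Pp Pm : T -> 'M[R]_d) (ev : (int -> 'cV[R]_d) -> 'cV[R]_(d + d)).
Let Pi l : 'M[R]_(d + d) := block_mx (Pp l) 0 0 (1%:M - Pm l).
Hypothesis HB : bordered L dl Pi ev.
Hypotheses (PPm : forall l, Pm l *m Pm l = Pm l) (PPp : forall l, Pp l *m Pp l = Pp l)
  (Pmc : continuous Pm).
Variables (k : nat) (s : 'I_k -> int -> 'cV[R]_d).
Hypothesis s0 : forall j, ell0 (s j).
Hypothesis Vadm : admissible L (span_of s).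

Let PiE l (t : 'cV[R]_(d + d)) : Pi l *m t = col_mx (Pp l *m usubmx t) ((1%:M - Pm l) *m dsubmx t).
Proof. by rewrite -{1}[t]vsubmxK mul_block_col !mul0mx addr0 add0r. Qed.

Lemma nsum_lt (X Y : lmodType R) (nX : X -> R) (nY : Y -> R) p (eps : R) :
  (nsum nX nY p < eps) = (nX p.1 < eps) && (nY p.2 < eps).
Proof. by rewrite /nsum gt_max. Qed.

(* Since [w] ranges over the whole of [R^d], [(phi, w) |-> (phi + rho w, w)] maps
   [E(V) + R^d] onto the pairs with [L phi + dl w] in [V], which the bordered
   operator maps onto [V + im Pp + ker Pm]; adding [im Pm] completes [ker Pm]
   to [R^d]. *)
Lemma KO_iso : bundle_iso
  (nsum (nsum (@supnorm R d) (@cvnorm R d)) (@cvnorm R d))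
  (nsum (nsum (@cvnorm R d) (@supnorm R d)) (@cvnorm R d))
  (bsum (bsum (EL L (span_of s)) (proj_im Pm)) (fun _ => setT))
  (bsum (bsum (proj_im Pp) (fun _ => span_of s)) (fun _ => setT)).
Proof.
pose lft l (p : (int -> 'cV[R]_d) * 'cV[R]_d * 'cV[R]_d) := p.1.1 + rho HB s l p.2.
pose t l p := Pi l *m ev (lft l p).
pose f l p := ((usubmx (t l p), L l (lft l p) + dl p.2), dsubmx (t l p) + p.1.2).
pose E := bsum (bsum (EL L (span_of s)) (proj_im Pm)) (fun _ : T => [set: 'cV[R]_d]).
have lft0 l p : E l p -> ell0 (lft l p).
  by move=> [[[p0 _] _] _]; apply: ell0_add => //; exact: (rho_ell0 HB s0).
have lft_span l p : E l p -> span_of s (L l (lft l p) + dl p.2).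
  move=> [[[p0 ps] _] _]; rewrite /lft -[p.1.1]scale1r (bL_lin HB) scale1r -addrA.
  by apply: span_of_add => //; exact: (rho_span HB s0 Vadm).
have lft_lin l (a : R) p q : lft l (a *: p + q) = a *: lft l p + lft l q.
  rewrite /lft -[(a *: p + q).1.1]/(a *: p.1.1 + q.1.1) -[(a *: p + q).2]/(a *: p.2 + q.2).
  by rewrite (rho_lin HB s0) scalerDr addrACA.
(* The rest of the last component lies in [ker Pm], so [Pm] extracts the summand [p.1.2];
   injectivity and continuity of the inverse both start here. *)
have zE l p : E l p -> p.1.2 = Pm l *m (f l p).2.
  move=> [[_ [y /= ->]] _]; rewrite /f /t PiE col_mxKd mulmxDr !mulmxA mulmxBr mulmx1 !PPm.
  by rewrite subrr mul0mx add0r.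
have tE l p : E l p -> t l p = col_mx (f l p).1.1 ((f l p).2 - Pm l *m (f l p).2).
  by move=> Ep; rewrite -(zE _ _ Ep) /f /= addrK vsubmxK.
exists f; split; [|split].
- move=> l; split; [|split].
  + move=> a p q _ _.
    have tl : t l (a *: p + q) = a *: t l p + t l q.
      by rewrite /t lft_lin (bev_lin HB) mulmxDr -scalemxAr.
    apply: injective_projections; [apply: injective_projections|].
    * by rewrite -[LHS]/(usubmx (t l (a *: p + q))) tl linearP.
    * rewrite -[LHS]/(L l (lft l (a *: p + q)) + dl (a *: p.2 + q.2)) lft_lin.
      by rewrite (bL_lin HB) (bdl_lin HB) addrACA -scalerDr.
    * rewrite -[LHS]/(dsubmx (t l (a *: p + q)) + (a *: p.1.2 + q.1.2)) tl linearP.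
      by rewrite addrACA -scalerDr.
  + move=> p q Ep Eq fpq.
    have [||||El Ew] := @D_inj _ _ _ _ _ _ _ _ HB l (lft l p) p.2 (lft l q) q.2.
    * exact: lft0.
    * exact: lft0.
    * by have := congr1 (fun x => x.1.2) fpq.
    * by rewrite -[LHS]/(t l p) -[RHS]/(t l q) !tE// fpq.
    have Ez : p.1.2 = q.1.2 by rewrite (zE l p)// (zE l q)// fpq.
    move: El; rewrite /lft Ew => /addIr.
    by case: (p) (q) Ew Ez => [[p1 p2] p3] [[q1 q2] q3] /= -> -> ->.
  + apply/seteqP; split=> [_ [p Ep <-]|[[xi v] y] [[[x /= xiE] vs] _]].
      split=> //; split; last exact: lft_span.
      by exists (usubmx (ev (lft l p))); rewrite /f /= /t PiE col_mxKu.
    have v0 := span_of_ell0 s0 vs.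
    (* [Pi l] reduces [y] to [(1 - Pm) y]; the part [Pm y] becomes the middle component of the
       preimage. *)
    have [q1 q2 q3] := bsolP HB l (col_mx xi y) v0.
    set phi := (bsol HB l v (col_mx xi y)).1 in q1 q2 q3.
    set w := (bsol HB l v (col_mx xi y)).2 in q2.
    have lE : lft l (phi - rho HB s l w, Pm l *m y, w) = phi by rewrite /lft /= subrK.
    exists (phi - rho HB s l w, Pm l *m y, w).
      split=> //; split; last by exists y.
      split; first by apply: ell0_sub => //; exact: (rho_ell0 HB s0).
      rewrite /= (LB HB).
      have -> : L l phi - L l (rho HB s l w) = v - (L l (rho HB s l w) + dl w).
        by rewrite -q2 opprD addrACA subrr addr0.
      by apply: span_of_sub => //; exact: (rho_span HB s0 Vadm).
    rewrite /f /t lE q3 q2 PiE col_mxKu !col_mxKd col_mxKu /=.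
    by rewrite xiE mulmxA PPp mulmxBl mul1mx subrK.
- move=> l1 p1 E1.
  apply: (@eps_delta _ _ _ E l1 (fun l p => nsum (nsum (@supnorm R d) (@cvnorm R d)) (@cvnorm R d) (p - p1))
    (fun l p => nsum (nsum (@cvnorm R d) (@supnorm R d)) (@cvnorm R d) (f l p - f l1 p1))) => F FF Fl Fd Fc.
  have p10 : ell0 p1.1.1 by case: E1 => [[[]]].
  have pF : \forall p \near F, ell0 p.2.1.1 by apply: filterS Fd => p [[[]]].
  have phic : ucvg F (fun p => p.2.1.1) p1.1.1.
    apply/(ucvg_ltP FF p10 pF) => eps /Fc; apply: filterS => p.
    by rewrite !nsum_lt => /andP[/andP[]].
  have zc : p.2.1.2 @[p --> F] --> p1.1.2.
    apply/(@cvg_lt_normP _ _ F FF _ _ (fun p => p.2.1.2)) => eps /Fc; apply: filterS => p.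
    by rewrite !nsum_lt => /andP[/andP[]].
  have wc : p.2.2 @[p --> F] --> p1.2.
    apply/(@cvg_lt_normP _ _ F FF _ _ (fun p => p.2.2)) => eps /Fc; apply: filterS => p.
    by rewrite !nsum_lt => /andP[].
  have lc : ucvg F (fun p => lft p.1 p.2) (lft l1 p1).
    by apply: ucvgD => //; exact: (cvg_rho HB s0 Vadm).
  have tc : t p.1 p.2 @[p --> F] --> t l1 p1.
    by apply: cvg_mulmx; [exact: (cvg_Pi HB Fl)|exact: (cvg_ev HB lc)].
  have vc : ucvg F (fun p => L p.1 (lft p.1 p.2) + dl p.2.2) (L l1 (lft l1 p1) + dl p1.2).
    by apply: ucvgD; [exact: (cvg_L HB Fl (lft0 _ _ E1) lc)|exact: (cvg_dl HB wc)].
  have v1 : ell0 (L l1 (lft l1 p1) + dl p1.2) by apply: (span_of_ell0 s0); exact: lft_span.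
  have vF : \forall p \near F, ell0 (L p.1 (lft p.1 p.2) + dl p.2.2).
    by apply: filterS Fd => p /lft_span/(span_of_ell0 s0).
  have vlt := (ucvg_ltP FF v1 vF).1 vc.
  have yc : dsubmx (t p.1 p.2) + p.2.1.2 @[p --> F] --> dsubmx (t l1 p1) + p1.1.2.
    by apply: cvgD; [exact: cvg_dsubmx|exact: zc].
  have ylt := (@cvg_lt_normP _ _ F FF _ _ (fun p => dsubmx (t p.1 p.2) + p.2.1.2) _).1 yc.
  move=> eps eps0; near=> p; rewrite !nsum_lt; apply/andP; split; first (apply/andP; split).
  + near: p; move/cvg_usubmx/(@cvg_lt_normP _ _ F FF _ _ (fun p => usubmx (t p.1 p.2))): tc.
    exact.
  + by near: p; exact: vlt.
  + by near: p; exact: ylt.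
- move=> l1 p1 E1.
  apply: (@eps_delta _ _ _ E l1
    (fun l p => nsum (nsum (@cvnorm R d) (@supnorm R d)) (@cvnorm R d) (f l p - f l1 p1))
    (fun l p => nsum (nsum (@supnorm R d) (@cvnorm R d)) (@cvnorm R d) (p - p1))) => F FF Fl Fd Fc.
  have p10 : ell0 p1.1.1 by case: E1 => [[[]]].
  have pF : \forall p \near F, ell0 p.2.1.1 by apply: filterS Fd => p [[[]]].
  have xc : (f p.1 p.2).1.1 @[p --> F] --> (f l1 p1).1.1.
    apply/(@cvg_lt_normP _ _ F FF _ _ (fun p => (f p.1 p.2).1.1)) => eps /Fc; apply: filterS => p.
    by rewrite !nsum_lt => /andP[/andP[]].
  have yc : (f p.1 p.2).2 @[p --> F] --> (f l1 p1).2.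
    apply/(@cvg_lt_normP _ _ F FF _ _ (fun p => (f p.1 p.2).2)) => eps /Fc; apply: filterS => p.
    by rewrite !nsum_lt => /andP[].
  have vc : ucvg F (fun p => L p.1 (lft p.1 p.2) + dl p.2.2) (L l1 (lft l1 p1) + dl p1.2).
    apply/(ucvg_ltP FF).
    + by apply: (span_of_ell0 s0); exact: lft_span.
    + by apply: filterS Fd => p /lft_span/(span_of_ell0 s0).
    + move=> eps /Fc; apply: filterS => p.
      by rewrite !nsum_lt => /andP[/andP[]].
  have Pmyc : Pm p.1 *m (f p.1 p.2).2 @[p --> F] --> Pm l1 *m (f l1 p1).2.
    by apply: cvg_mulmx; [exact: cvg_comp Fl (Pmc (x:=l1))|exact: yc].
  have tc : t p.1 p.2 @[p --> F] --> t l1 p1.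
    rewrite (tE _ _ E1).
    apply: (@cvg_trans _ (col_mx (f p.1 p.2).1.1
        ((f p.1 p.2).2 - Pm p.1 *m (f p.1 p.2).2) @[p --> F])).
      by apply: near_eq_cvg; apply: filterS Fd => p Ep; rewrite -tE.
    by apply: cvg_col_mx => //; apply: cvgB; [exact: yc|exact: Pmyc].
  have zc : p.2.1.2 @[p --> F] --> p1.1.2.
    rewrite (zE _ _ E1); apply: cvg_trans Pmyc.
    by apply: near_eq_cvg; apply: filterS Fd => p Ep; rewrite -zE.
  (* [lft] and the jump together are the bordered preimage of data already known to converge. *)
  have [lc wc] : ucvg F (fun p => lft p.1 p.2) (lft l1 p1) /\ p.2.2 @[p --> F] --> p1.2.
    apply: (cvg_D_inv HB Fl) => //; first exact: lft0.
    by apply: filterS Fd => p /lft0.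
  have phic : ucvg F (fun p => p.2.1.1) p1.1.1.
    rewrite -(addrK (rho HB s l1 p1.2) p1.1.1).
    apply: (@ucvg_near _ _ _ _ _ _ (fun p => lft p.1 p.2 - rho HB s p.1 p.2.2)).
      by apply: nearW => p; rewrite /lft addrK.
    by apply: ucvgB => //; exact: (cvg_rho HB s0 Vadm).
  move=> eps eps0; near=> p; rewrite !nsum_lt; apply/andP; split; first (apply/andP; split).
  + by near: p; move: eps eps0; apply/(ucvg_ltP FF).
  + by near: p; move/(@cvg_lt_normP _ _ F FF _ _ (fun p => p.2.1.2)): zc; exact.
  + by near: p; move/(@cvg_lt_normP _ _ F FF _ _ (fun p => p.2.2)): wc; exact.
Unshelve. all: by end_near. Qed.

End KOIso.

(** * The difference operator as a bordered family *)

Section DifferenceOperator.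
Variables (R : realType) (T : pseudoMetricType R) (d : nat).
Variables (A : int -> T -> 'M[R]_d) (kup klo : int) (Pp Pm : T -> int -> 'M[R]_d).

Definition end_proj l : 'M[R]_(d + d) := block_mx (Pp l kup) 0 0 (1%:M - Pm l klo).

Definition end_values (phi : int -> 'cV[R]_d) : 'cV[R]_(d + d) :=
  col_mx (phi kup) (phi klo).

Lemma LA_lin l (a : R) phi psi : LA A l (a *: phi + psi) = a *: LA A l phi + LA A l psi.
Proof.
apply/funext => n.
rewrite -[RHS]/(a *: (phi (n + 1) - A n l *m phi n) + (psi (n + 1) - A n l *m psi n)).
rewrite -[LHS]/(a *: phi (n + 1) + psi (n + 1) - A n l *m (a *: phi n + psi n)).
by rewrite mulmxDr -scalemxAr opprD addrACA scalerBr.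
Qed.

Hypothesis HL0 : L0 A.

Lemma LA_bound l : exists2 C : R, 0 <= C & forall phi b,
  (forall n, `|phi n| <= b) -> forall n, `|LA A l phi n| <= C * b.
Proof.
have [M HM] := HL0.2 l; have M0 : 0 <= M by exact: le_trans (normr_ge0 _) (HM 0).
exists (1 + d%:R * M); first by rewrite addr_ge0// mulr_ge0.
move=> phi b Hb n; rewrite /LA (le_trans (ler_normB _ _))// mulrDl mul1r lerD//.
by rewrite (le_trans (mulmx_norm_le _ _))// ler_pM ?mulr_ge0// ler_wpM2l.
Qed.

Lemma LA_ell0 l phi : ell0 phi -> ell0 (LA A l phi).
Proof.
have [M HM] := HL0.2 l; have M0 : 0 <= M by exact: le_trans (normr_ge0 _) (HM 0).
have C0 : 0 < 1 + d%:R * M by rewrite ltr_pwDl// mulr_ge0.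
move=> p; apply: ell0P => eps eps0.
have [N HN] := p _ (divr_gt0 eps0 C0); exists N.+1 => n Nn.
have h1 : `|phi (n + 1)| <= eps / (1 + d%:R * M) by apply/ltW/HN; move: Nn; clear; lia.
have h2 : `|phi n| <= eps / (1 + d%:R * M) by apply/ltW/HN; move: Nn; clear; lia.
rewrite /LA (le_trans (ler_normB _ _))//.
apply: (@le_trans _ _ ((1 + d%:R * M) * (eps / (1 + d%:R * M)))).
  rewrite mulrDl mul1r lerD//.
  by rewrite (le_trans (mulmx_norm_le _ _))// ler_pM ?mulr_ge0// ler_wpM2l.
by rewrite mulrC divfK// gt_eqF.
Qed.

Lemma LA_cont l1 (eps : R) : 0 < eps -> exists2 eta : R, 0 < eta &
  forall l phi b, ball l1 eta l -> (forall n, `|phi n| <= b) ->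
    forall n, `|LA A l phi n - LA A l1 phi n| <= eps * b.
Proof.
(* The divisor [d.+1] offsets the dimension factor of [mulmx_norm_le]; equicontinuity makes [eta]
   uniform in time. *)
move=> eps0; have d1 : (0 : R) < d.+1%:R by [].
have [eta eta0 H] := HL0.1 l1 _ (divr_gt0 eps0 d1); exists eta => // l phi b ll Hb n.
rewrite /LA opprD addrACA subrr add0r opprK addrC -mulmxBl.
rewrite (le_trans (mulmx_norm_le _ _))// ler_pM ?mulr_ge0//.
rewrite distrC (le_trans (ler_wpM2l _ (ltW (H n l ll))))// mulrCA ler_piMr ?(ltW eps0)//.
by rewrite ler_pdivrMr// mul1r ler_nat.
Qed.

Hypotheses (klo_kup : klo < kup)
  (dichp : exp_dichotomy A [set n : int | kup <= n] Pp)
  (dichm : exp_dichotomy A [set n : int | n <= klo] Pm).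

Lemma Pp_proj l : Pp l kup *m Pp l kup = Pp l kup.
Proof.
by have [_ [K [a [_ [_ /(_ l)[[PP _] _]]]]]] := dichp; apply: PP => /=.
Qed.

Lemma Pm_proj l : Pm l klo *m Pm l klo = Pm l klo.
Proof.
by have [_ [K [a [_ [_ /(_ l)[[PP _] _]]]]]] := dichm; apply: PP => /=.
Qed.

Lemma Pp_cont : continuous (fun l => Pp l kup).
Proof. by have [H _] := dichp; apply: H => /=. Qed.

Lemma Pm_cont : continuous (fun l => Pm l klo).
Proof. by have [H _] := dichm; apply: H => /=. Qed.

Lemma end_projE l (t : 'cV[R]_(d + d)) :
  end_proj l *m t = col_mx (Pp l kup *m usubmx t) ((1%:M - Pm l klo) *m dsubmx t).
Proof. by rewrite -{1}[t]vsubmxK mul_block_col !mul0mx addr0 add0r. Qed.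

Lemma LA_bordered : bordered (LA A) (dirac_seq (kup - 1)) end_proj end_values.
Proof.
have [_ [K [al [K1 [al1 Hp]]]]] := dichp.
have [_ [K' [al' [K1' [al1' Hm]]]]] := dichm.
split.
- exact: LA_lin.
- exact: LA_ell0.
- exact: LA_bound.
- exact: LA_cont.
- exact: dirac_seq_lin.
- exact: dirac_seq_ell0.
- exact: dirac_seq_le.
- move=> l; apply: matrix_mulP => t; rewrite -mulmxA !end_projE col_mxKu col_mxKd.
  rewrite !mulmxA Pp_proj [X in X *m dsubmx t](_ : _ = 1%:M - Pm l klo)//.
  by rewrite mulmxBl mul1mx mulmxBr mulmx1 Pm_proj subrr subr0.
- move=> l; apply: cvg_block_diag; first exact: Pp_cont.
  by apply: cvgB; [exact: cvg_cst|exact: Pm_cont].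
- by move=> a phi psi; rewrite scale_col_mx add_col_mx.
- move=> phi b Hb; have b0 : 0 <= b by exact: le_trans (normr_ge0 _) (Hb 0).
  apply: mx_norm_le => // i j; rewrite mxE.
  by case: (fintype.split i) => i'; exact: le_trans (mx_coord_le _ _ _) (Hb _).
- move=> l psi t psi0; rewrite end_projE -{3}[t]vsubmxK => /eq_col_mx[E1 E2].
  have E3 : Pm l klo *m dsubmx t = 0.
    by rewrite -E2 mulmxA mulmxBr mulmx1 Pm_proj subrr mul0mx.
  have [phi [w [p H1 H2 H3]]] := line_exists klo_kup K1 al1 (Hp l).1 (Hp l).2
    K1' al1' (Hm l).1 (Hm l).2 psi0 E1 E3.
  exists phi, w; split=> //; first exact/funext.
  by rewrite end_projE col_mxKu col_mxKd H2 H3 vsubmxK.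
- move=> l; have [C C0 H] := line_bound klo_kup K1 al1 (Hp l).1 (Hp l).2
    K1' al1' (Hm l).1 (Hm l).2.
  exists C => // phi w b p H1; rewrite end_projE col_mxKu col_mxKd => H2.
  have b0 : 0 <= b by exact: le_trans (normr_ge0 _) H2.
  apply: H => //; apply: mx_norm_le => // i j; apply: le_trans H2.
    by rewrite -(col_mxEu _ ((1%:M - Pm l klo) *m phi klo)) mx_coord_le.
  by rewrite -(col_mxEd (Pp l kup *m phi kup)) mx_coord_le.
Qed.

End DifferenceOperator.

Theorem theorem5p7 (R : realType) (Lam : metricType R) (d : nat)
    (A : int -> Lam -> 'M[R]_d) (kup klo : int)
    (Pp Pm : Lam -> int -> 'M[R]_d) :
  compact [set: Lam] -> path_connected_space R Lam ->
  L0 A ->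
  klo < 0 -> 0 < kup ->
  exp_dichotomy A [set n : int | kup <= n] Pp ->
  exp_dichotomy A [set n : int | n <= klo] Pm ->
  cont_fredholm_family (LA A) /\
  (vbundle (@cvnorm R d) (IM Pp kup) /\ vbundle (@cvnorm R d) (IM Pm klo) /\
   (exists V, admissible (LA A) V) /\
   forall V, admissible (LA A) V ->
     vbundle (@supnorm R d) (EL (LA A) V) /\
     KO_eq (@supnorm R d) (@supnorm R d) (@cvnorm R d) (@cvnorm R d)
       (EL (LA A) V) (fun _ : Lam => V) (IM Pp kup) (IM Pm klo)).
Proof.
move=> _ _ HL0 klo0 kup0 dp dm.
have HB := LA_bordered HL0 (lt_trans klo0 kup0) dp dm.
have PPp := Pp_proj dp; have PPm := Pm_proj dm.
split; first exact: bordered_fredholm HB.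
split; first exact: (@proj_vbundle R Lam d (fun l => Pp l kup) PPp (Pp_cont dp)).
split; first exact: (@proj_vbundle R Lam d (fun l => Pm l klo) PPm (Pm_cont dm)).
split; first exact: bordered_admissible HB.
(* A free family gives unique coefficients in [V], on which the inverse in [EL_iso] relies. *)
move=> V Vadm; have [k [s [s0 Vs sfree]]] := free_spanning Vadm.1.
rewrite Vs in Vadm *; split; first exact: (EL_vbundle HB).
(* The cancelling summand is the trivial bundle of jumps, presented below as the image of the
   identity projector. *)
exists d, (fun _ => setT); split.
  have -> : (fun _ : Lam => [set: 'cV[R]_d]) = proj_im (fun _ => 1%:M).
    by apply/funext => l; apply/seteqP; split=> // x _; exists x; rewrite mul1mx.
  apply: proj_vbundle => [l|l]; first by rewrite mul1mx.
  exact: cvg_cst.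
exact: (@KO_iso R d Lam (LA A) _ (fun l => Pp l kup) (fun l => Pm l klo) _
  HB PPm PPp (Pm_cont dm) k s s0 Vadm).
Qed.
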